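(* Let $\mathbb{K}$ be a field and let $G$ be a finite digraph satisfying property $(\mathcal{V}_2)$: any two shortest paths connecting the same vertices are $2$-shortly congruent, and any long path is $2$-quasi-reducible. Consider the graded left $\Omega^\bullet(G)$-modules $$\mathsf{K}^G_n=\bigoplus_{d(x,y)=n}\Omega^\bullet(G)\cdot e_x$$ (sum over all pairs of vertices $(x,y)$ with $d(x,y)=n$), let $\kappa_{x,y}\in\mathsf{K}^G_n$ be the element $e_x$ of the summand indexed by $(x,y)$, graded by $|\kappa_{x,y}|=d(x,y)$, and let $\partial:\mathsf{K}^G_n\to\mathsf{K}^G_{n-1}$ be the homomorphism of left $\Omega^\bullet(G)$-modules given on generators by $$\partial(\kappa_{x,y})=\sum_{\substack{v:\ d(x,v)=1\\ d(v,y)=n-1}}(x,v)\cdot\kappa_{v,y}.$$ Then $\mathsf{K}^G_\bullet$ is a well-defined chain complex, and it is isomorphic to the Koszul complex of the path cochain algebra $\Omega^\bullet(G)$.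
   Context: A digraph $G$ consists of a set of vertices and a set of arrows, which are ordered pairs of distinct vertices. A path of length $n\ge 0$ is a tuple of vertices $p=(p_0,\dots,p_n)$ such that each $(p_i,p_{i+1})$ is an arrow; $d(x,y)$ is the infimum of lengths of paths from $x$ to $y$ ($\infty$ if there are none). A path is shortest if $d(p_0,p_n)=n$, and long otherwise. A subpath of $p$ is a path $(p_i,\dots,p_j)$. Paths connect the same vertices if they have the same initial and terminal vertices. An equivalence relation $\sim$ on paths is a congruence if $p\sim\tilde p$ implies that $p,\tilde p$ connect the same vertices and $qpq'\sim q\tilde pq'$ whenever the concatenations are defined. The $2$-short congruence is the minimal congruence such that any two shortest paths connecting the same two vertices at distance at most $2$ are equivalent. A long path is $2$-reducible if it contains a long subpath of length at most $2$, and $2$-quasi-reducible if it is $2$-shortly congruent to a $2$-reducible path. $\mathbb{K}G$ is the path algebra (free on all paths, including the length-zero paths $e_x=(x)$; product = concatenation, first path followed by the second, or zero; graded by length). The path cochain algebra $\Omega^\bullet(G)$ is isomorphic as a graded algebra to $\mathbb{K}G/T$, where $T$ is the ideal generated by the elements $t_{x,y}=\sum_v(x,v,y)$ for all pairs with $d(x,y)=2$, the sum running over all vertices $v$ such that $(x,v,y)$ is a path; here this may be taken as its definition. It is a quadratic algebra with this presentation. Koszul complex: for a finite quiver $Q$ with set of arrows $Q_1$, let $A=\mathbb{K}Q/I$ be quadratic, i.e. $I$ is a homogeneous ideal (path-length grading) generated by $I_2$. Let $A^!=\mathbb{K}Q^{op}/I^\perp$, where $I^\perp$ is the ideal generated by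 the orthogonal complement $I_2^\perp\subseteq(\mathbb{K}Q^{op})_2$ of $I_2$ with respect to the bilinear form on $(\mathbb{K}Q)_2\times(\mathbb{K}Q^{op})_2$ with $\langle p,q\rangle=\delta_{p^{op},q}$ on paths. Put $S=(\mathbb{K}Q)_0=(\mathbb{K}Q^{op})_0$. The Koszul complex $\mathsf{K}_\bullet$ of $A$ is the chain complex of graded left $A$-modules $\mathsf{K}_n=\mathrm{Hom}_S(A^!_n,A)$ (graded Hom of right $S$-modules), with homogeneous components $(\mathsf{K}_n)_{n+i}=\mathrm{Hom}_S(A^!_n,A_i)$ and differential $\partial:\mathsf{K}_n\to\mathsf{K}_{n-1}$, $\partial(\varphi)(a)=\sum_{\alpha\in Q_1}\varphi(a\alpha^{op})\cdot\alpha$. *)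

(* Defs.v *)
From HB Require Import structures.
From mathcomp Require Import all_boot all_algebra.
From mathcomp Require Import finmap.
From mathcomp Require Import boolp classical_sets functions.
From mathcomp.multinomials Require Import monalg.

Set Implicit Arguments.
Unset Strict Implicit.
Unset Printing Implicit Defensive.

Import GRing.Theory.
Local Open Scope ring_scope.
Local Open Scope classical_set_scope.

Record digraph := Digraph {
  vertex :> finType;
  arrow : rel vertex;
  arrow_irr : irreflexive arrow }.

Definition opdigraph (G : digraph) : digraph :=
  @Digraph G (fun x y => arrow y x) (@arrow_irr G).

(* The path (p_0, ..., p_n) is stored as the pair of p_0 and [:: p_1; ...; p_n]. *)
Record gpath (G : digraph) := GPath {
  gpval : G * seq G;
  gpvalP : path (@arrow G) gpval.1 gpval.2 }.
HB.instance Definition _ G := [isSub for @gpval G].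
HB.instance Definition _ G := [Choice of gpath G by <:].

Section Paths.
Variable G : digraph.
Implicit Types p q r : gpath G.

Definition pstart p : G := (gpval p).1.
Definition ptail p : seq G := (gpval p).2.
Definition pverts p : seq G := pstart p :: ptail p.
Definition pend p : G := last (pstart p) (ptail p).
Definition plen p : nat := size (ptail p).

(* [insub] cannot fail in the first branch. *)
Definition pcat p q : option (gpath G) :=
  if pend p == pstart q then insub (pstart p, ptail p ++ ptail q) else None.

Definition pop p : gpath (opdigraph G) :=
  @GPath (opdigraph G) (pend p, rev (belast (pstart p) (ptail p)))
    (etrans (rev_path (@arrow (opdigraph G)) (pstart p) (ptail p)) (gpvalP p)).

Definition subpath q p : bool := infix (pverts q) (pverts p).

Definition connect_same p q : Prop := pstart p = pstart q /\ pend p = pend q.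

Definition has_path (x y : G) (n : nat) : bool :=
  `[< exists p, [/\ pstart p = x, pend p = y & plen p = n] >].

(* [None] stands for infinity. *)
Definition dist (x y : G) : option nat :=
  if pselect (exists n, has_path x y n) is left ex then Some (ex_minn ex)
  else None.

Definition shortest p : Prop := dist (pstart p) (pend p) = Some (plen p).
Definition long p : Prop := ~ shortest p.

Definition congruence (R : set (gpath G * gpath G)) : Prop :=
  [/\ (forall p, R (p, p)),
      (forall p q, R (p, q) -> R (q, p)),
      (forall p q r, R (p, q) -> R (q, r) -> R (p, r)),
      (forall p q, R (p, q) -> connect_same p q)
    & (forall p p' q q' r r', R (p, p') ->
         obind (pcat^~ q') (pcat q p) = Some r ->
         obind (pcat^~ q') (pcat q p') = Some r' -> R (r, r'))].

Definition two_shortly_congruent p q : Prop :=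
  smallest congruence
    [set pq | [/\ shortest pq.1, shortest pq.2, connect_same pq.1 pq.2
                & exists2 n, dist (pstart pq.1) (pend pq.1) = Some n
                           & (n <= 2)%N]]
    (p, q).

Definition two_reducible p : Prop :=
  long p /\ exists q, [/\ subpath q p, long q & (plen q <= 2)%N].

Definition two_quasi_reducible p : Prop :=
  long p /\ exists2 q, two_shortly_congruent p q & two_reducible q.

End Paths.

Definition V2 (G : digraph) : Prop :=
  (forall p q : gpath G, shortest p -> shortest q -> connect_same p q ->
     two_shortly_congruent p q) /\
  (forall p : gpath G, long p -> two_quasi_reducible p).

Arguments pcat {G} p q.

Section PathCat.
Variable G : digraph.
Implicit Types p q r : gpath G.

Lemma pcatP p q r :
  pcat p q = Some r <->
  pend p = pstart q /\ gpval r = (pstart p, ptail p ++ ptail q).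
Proof.
rewrite /pcat; case: eqP => [e|ne]; last by split=> // -[].
case: insubP => [u /= _ uE|/=]; first split.
- by case=> <-.
- by case=> _ rE; congr Some; apply: val_inj; rewrite /= uE rE.
by rewrite cat_path (gpvalP p) -/(ptail p) -/(pend p) e (gpvalP q).
Qed.

Lemma pcat_def p q : pend p = pstart q ->
  exists r, pcat p q = Some r.
Proof.
move=> e; have h : path (@arrow G) (pstart p) (ptail p ++ ptail q).
  by rewrite cat_path (gpvalP p) -/(pend p) e (gpvalP q).
by exists (@GPath G (pstart p, ptail p ++ ptail q) h); apply/pcatP.
Qed.

Lemma pcat_start p q r : pcat p q = Some r -> pstart r = pstart p.
Proof. by move/pcatP=> [_ rE]; rewrite /pstart rE. Qed.

Lemma pcat_end p q r : pcat p q = Some r -> pend r = pend q.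
Proof.
by move/pcatP=> [e rE]; rewrite /pend /pstart /ptail rE /= last_cat -/(pend p) e.
Qed.

Lemma pcat_len p q r : pcat p q = Some r -> plen r = (plen p + plen q)%N.
Proof. by move/pcatP=> [_ rE]; rewrite /plen /ptail rE size_cat. Qed.

Lemma pcatA p q r :
  obind (pcat p) (pcat q r) = obind (pcat^~ r) (pcat p q).
Proof.
case qr: (pcat q r) => [s|] /=; case pq: (pcat p q) => [t|] //=.
- case/pcatP: (qr) => e1 sE; case/pcatP: (pq) => e2 tE.
  have [u uE] : exists u, pcat p s = Some u.
    by apply: pcat_def; rewrite (pcat_start qr).
  rewrite uE; apply/esym/pcatP; split; first by rewrite (pcat_end pq).
  case/pcatP: uE => _ ->; rewrite (pcat_start pq).
  by rewrite /ptail sE tE /= catA.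
- case ps: (pcat p s) => [u|] //; case/pcatP: ps => e _.
  by move: e; rewrite (pcat_start qr) => /pcat_def[t]; rewrite pq.
- case tr: (pcat t r) => [u|] //; case/pcatP: tr => e _.
  by move: e; rewrite (pcat_end pq) => /pcat_def[s]; rewrite qr.
Qed.

Definition pnil (x : G) : gpath G := @GPath G (x, [::]) isT.

Lemma pnil_cat x p : pcat (pnil x) p = if x == pstart p then Some p else None.
Proof.
case: eqP => [->|ne]; first by apply/pcatP; split=> //=; case: p => -[].
by rewrite /pcat; case: eqP.
Qed.

Lemma pcat_nil x p : pcat p (pnil x) = if x == pend p then Some p else None.
Proof.
case: eqP => [->|ne].
  by apply/pcatP; split=> //=; rewrite cats0 /pstart /ptail; case: p => -[].
by rewrite /pcat; case: eqP => // e; case: ne.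
Qed.

End PathCat.

(* The monoid-algebra product of [{malg K[M]}] requires [M] to be a monoid, so
   only the underlying vector space is taken from the library. *)
Definition pathalg (K : fieldType) (G : digraph) : Type := {malg K[gpath G]}.

HB.instance Definition _ K G := GRing.Lmodule.on (pathalg K G).

HB.lock Definition pbasis (K : fieldType) (G : digraph) (p : gpath G) :
    pathalg K G := << p >>.

Definition pmul_basis (K : fieldType) (G : digraph) (p q : gpath G) :
    pathalg K G :=
  oapp (@pbasis K G) 0 (pcat p q).

HB.lock Definition pmul (K : fieldType) (G : digraph) (f g : pathalg K G) :
    pathalg K G :=
  \sum_(p <- msupp f) \sum_(q <- msupp g)
    (f@_p * g@_q) *: pmul_basis K p q.

Section PathAlgebra.
Variables (K : fieldType) (G : digraph).
Local Notation KG := (pathalg K G).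
Local Notation pmul := (@pmul K G).
Local Notation pb := (@pbasis K G).
Local Notation pmul_basis := (@pmul_basis K G).
Implicit Types (f g h : KG) (p q r : gpath G).

Definition pone : KG := \sum_(x : G) pb (pnil x).

Lemma pmulw (d1 d2 : {fset gpath G}) f g :
  fsubset (msupp f) d1 -> fsubset (msupp g) d2 ->
  pmul f g = \sum_(p <- d1) \sum_(q <- d2) (f@_p * g@_q) *: pmul_basis p q.
Proof.
move=> le1 le2; rewrite pmul.unlock (big_fset_incl _ le1) /=.
  apply/eq_bigr=> k1 _; apply/big_fset_incl => // k _ /mcoeff_outdom ->.
  by rewrite mulr0 scale0r.
move=> k _ /mcoeff_outdom fk.
by rewrite big1 // => k' _; rewrite fk mul0r scale0r.
Qed.

Lemma pmulDl : left_distributive pmul +%R.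
Proof.
move=> f g h.
rewrite (pmulw (msuppD_le f g) (fsubset_refl _)).
rewrite (pmulw (fsubsetUl (msupp f) (msupp g)) (fsubset_refl _)).
rewrite (pmulw (fsubsetUr (msupp f) (msupp g)) (fsubset_refl _)).
rewrite -big_split /=; apply/eq_bigr=> p _; rewrite -big_split /=.
by apply/eq_bigr=> q _; rewrite mcoeffD mulrDl scalerDl.
Qed.

Lemma pmulDr : right_distributive pmul +%R.
Proof.
move=> h f g.
rewrite (pmulw (fsubset_refl _) (msuppD_le f g)).
rewrite (pmulw (fsubset_refl _) (fsubsetUl (msupp f) (msupp g))).
rewrite (pmulw (fsubset_refl _) (fsubsetUr (msupp f) (msupp g))).
rewrite -big_split /=; apply/eq_bigr=> p _; rewrite -big_split /=.
by apply/eq_bigr=> q _; rewrite mcoeffD mulrDr scalerDl.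
Qed.

Lemma pmul0l f : pmul 0 f = 0.
Proof. by rewrite pmul.unlock msupp0 big_seq_fset0. Qed.

Lemma pmul0r f : pmul f 0 = 0.
Proof. by rewrite pmul.unlock big1 // => p _; rewrite msupp0 big_seq_fset0. Qed.

Lemma pmulZl c f g : pmul (c *: f) g = c *: pmul f g.
Proof.
rewrite (pmulw (msuppZ_le c f) (fsubset_refl _)) pmul.unlock scaler_sumr.
apply/eq_bigr=> p _; rewrite scaler_sumr; apply/eq_bigr=> q _.
by rewrite mcoeffZ scalerA mulrA.
Qed.

Lemma pmulZr c f g : pmul f (c *: g) = c *: pmul f g.
Proof.
rewrite (pmulw (fsubset_refl _) (msuppZ_le c g)) pmul.unlock scaler_sumr.
apply/eq_bigr=> p _; rewrite scaler_sumr; apply/eq_bigr=> q _.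
by rewrite mcoeffZ scalerA mulrCA.
Qed.

Lemma pmul_suml (I : Type) (s : seq I) (P : pred I) (F : I -> KG) g :
  pmul (\sum_(i <- s | P i) F i) g = \sum_(i <- s | P i) pmul (F i) g.
Proof. exact: (big_morph (pmul^~ g) (fun _ _ => pmulDl _ _ _) (pmul0l g)). Qed.

Lemma pmul_sumr (I : Type) (s : seq I) (P : pred I) (F : I -> KG) g :
  pmul g (\sum_(i <- s | P i) F i) = \sum_(i <- s | P i) pmul g (F i).
Proof. exact: (big_morph (pmul g) (fun _ _ => pmulDr _ _ _) (pmul0r g)). Qed.

Lemma pmulUU p q : pmul (pb p) (pb q) = pmul_basis p q.
Proof.
rewrite pbasis.unlock.
rewrite (pmulw (d1 := [fset p]%fset) (d2 := [fset q]%fset)) ?msuppU_le //.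
by rewrite !big_seq_fset1 !mcoeffUU mulr1 scale1r.
Qed.

Lemma palgE f : f = \sum_(p <- msupp f) f@_p *: pb p.
Proof.
rewrite pbasis.unlock {1}[f]monalgE; apply/eq_bigr => p _; apply/malgP => q.
rewrite mcoeffZ [LHS]mcoeffU [X in _ * X]mcoeffU; move: f@_p => c.
case: (p == q).
  by rewrite [LHS]mulr1n [X in _ * X]mulr1n mulr1.
by rewrite [LHS]mulr0n [X in _ * X]mulr0n mulr0.
Qed.

Lemma palg_ind (P : KG -> Prop) :
  P 0 -> (forall f g, P f -> P g -> P (f + g)) ->
  (forall c f, P f -> P (c *: f)) -> (forall p, P (pb p)) -> forall f, P f.
Proof.
move=> P0 PD PZ PU f; rewrite [f]palgE.
by apply: (big_ind P) => // p _; apply: PZ; apply: PU.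
Qed.

Lemma pmulA : associative pmul.
Proof.
move=> f g h; elim/palg_ind: f => [|f f' Hf Hf'|c f Hf|p].
- by rewrite 3!pmul0l.
- by rewrite 3!pmulDl Hf Hf'.
- by rewrite 3!pmulZl Hf.
elim/palg_ind: g => [|g g' Hg Hg'|c g Hg|q].
- by rewrite pmul0l pmul0r pmul0l.
- by rewrite pmulDl 2!pmulDr pmulDl Hg Hg'.
- move: (pb p) Hg => u Hg.
  rewrite pmulZl; apply: etrans (pmulZr c u (pmul g h)) _; rewrite Hg.
  apply: etrans (esym (pmulZl c (pmul u g) h)) _.
  by congr (pmul _ h); exact: esym (pmulZr c u g).
elim/palg_ind: h => [|h h' Hh Hh'|c h Hh|r].
- by rewrite 3!pmul0r.
- by rewrite 3!pmulDr Hh Hh'.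
- by rewrite 3!pmulZr Hh.
rewrite 2!pmulUU /pmul_basis; move: (pcatA p q r).
case: (pcat q r) => [s|]; case: (pcat p q) => [t|] /= e.
- by rewrite 2!pmulUU /pmul_basis e.
- by rewrite pmul0l pmulUU /pmul_basis e.
- by rewrite pmul0r pmulUU /pmul_basis -e.
- by rewrite pmul0l pmul0r.
Qed.

Lemma pmul1l : left_id pone pmul.
Proof.
move=> f; elim/palg_ind: f => [|f f' Hf Hf'|c f Hf|p].
- by rewrite pmul0r.
- by rewrite pmulDr Hf Hf'.
- by rewrite pmulZr Hf.
rewrite pmul_suml (bigD1 (pstart p)) //= big1 ?addr0 => [|x ne].
  by rewrite pmulUU /pmul_basis pnil_cat eqxx.
by rewrite pmulUU /pmul_basis pnil_cat (negPf ne).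
Qed.

Lemma pmul1r : right_id pone pmul.
Proof.
move=> f; elim/palg_ind: f => [|f f' Hf Hf'|c f Hf|p].
- by rewrite pmul0l.
- by rewrite pmulDl Hf Hf'.
- by rewrite pmulZl Hf.
rewrite pmul_sumr (bigD1 (pend p)) //= big1 ?addr0 => [|x ne].
  by rewrite pmulUU /pmul_basis pcat_nil eqxx.
by rewrite pmulUU /pmul_basis pcat_nil (negPf ne).
Qed.

HB.instance Definition _ :=
  GRing.Zmodule_isPzRing.Build KG pmulA pmul1l pmul1r pmulDl pmulDr.

Lemma pscalerAl (c : K) f g : c *: (f * g) = (c *: f) * g.
Proof. by rewrite [RHS]pmulZl. Qed.

Lemma pscalerAr (c : K) f g : c *: (f * g) = f * (c *: g).
Proof. by rewrite [RHS]pmulZr. Qed.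

Lemma pbasisM p q : pb p * pb q = pmul_basis p q.
Proof. exact: pmulUU. Qed.

(* The basis element (x, s_1, ..., s_n) of KG, or 0 if this is not a path. *)
Definition pelt (x : G) (s : seq G) : KG := oapp pb 0 (insub (x, s)).

Definition supported (P : pred nat) : set KG :=
  [set f | forall p, f@_p != 0 -> P (plen p)].

Definition homog (n : nat) : set KG := supported (pred1 n).

(* The identification of S = K^G with the subalgebra (KG)_0. *)
Definition emb0 (s : {ffun G -> K}) : KG := \sum_x s x *: pelt x [::].

Lemma supported0 P : supported P 0.
Proof. by move=> p; rewrite mcoeff0 eqxx. Qed.

Lemma supportedD P f g : supported P f -> supported P g -> supported P (f + g).
Proof.
move=> hf hg p; rewrite mcoeffD.
have [-> |/hf//] := eqVneq f@_p 0; rewrite add0r; exact: hg.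
Qed.

Lemma supportedN P f : supported P f -> supported P (- f).
Proof. by move=> hf p; rewrite mcoeffN oppr_eq0; apply: hf. Qed.

Lemma supportedZ P c f : supported P f -> supported P (c *: f).
Proof.
move=> hf p; rewrite mcoeffZ => ne; apply: hf.
by apply: contraNneq ne => ->; rewrite mulr0.
Qed.

Lemma supported_basis (P : pred nat) p : P (plen p) -> supported P (pb p).
Proof.
move=> Pp q; rewrite pbasis.unlock mcoeffU.
by case: (p =P q) => [<-//|_]; rewrite mulr0n eqxx.
Qed.

Lemma supported_sum P (I : Type) (s : seq I) (Q : pred I) (F : I -> KG) :
  (forall i, Q i -> supported P (F i)) -> supported P (\sum_(i <- s | Q i) F i).
Proof.
move=> h; elim/big_ind: _ => //; first exact: supported0.
exact: supportedD.
Qed.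

Lemma supportedM (P Q U : pred nat) f g :
  (forall i j, P i -> Q j -> U (i + j)%N) ->
  supported P f -> supported Q g -> supported U (f * g).
Proof.
move=> h hf hg; rewrite /GRing.mul /= pmul.unlock.
rewrite big_seq_cond; apply: supported_sum => p; rewrite andbT => pf.
rewrite big_seq_cond; apply: supported_sum => q; rewrite andbT => qg.
apply: supportedZ; rewrite /pmul_basis; case e: pcat => [r|] /=; last exact: supported0.
apply: supported_basis; rewrite (pcat_len e); apply: h.
  by apply: hf; rewrite mcoeff_neq0.
by apply: hg; rewrite mcoeff_neq0.
Qed.

Lemma supported_pelt (P : pred nat) x s : P (size s) -> supported P (pelt x s).
Proof.
move=> Ps; rewrite /pelt; case: insubP => [p _ pE|_] /=; last exact: supported0.
by apply: supported_basis; rewrite /plen /ptail pE.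
Qed.

Lemma supported_emb0 (P : pred nat) s : P 0%N -> supported P (emb0 s).
Proof.
by move=> P0; apply: supported_sum => x _; apply: supportedZ; apply: supported_pelt.
Qed.

Lemma supported_ltn f : exists n, supported (ltn^~ n) f.
Proof.
exists (\max_(p <- msupp f) plen p).+1 => p; rewrite mcoeff_neq0 => pf.
by rewrite /= ltnS (bigD1_seq p) ?fset_uniq //= leq_maxl.
Qed.

Lemma pelt_nil x : pelt x [::] = pb (pnil x).
Proof.
rewrite /pelt; case: insubP => [p _ pE|//] /=.
by congr pbasis; apply: val_inj.
Qed.

Lemma emb0_basis s p : emb0 s * pb p = s (pstart p) *: pb p.
Proof.
rewrite /emb0 mulr_suml (bigD1 (pstart p)) //= big1 ?addr0 => [|x ne];
  rewrite pelt_nil [LHS]pmulZl pmulUU /pmul_basis pnil_cat ?eqxx //.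
by rewrite (negPf ne) /= scaler0.
Qed.

Lemma basis_emb0 s p : pb p * emb0 s = s (pend p) *: pb p.
Proof.
rewrite /emb0 mulr_sumr (bigD1 (pend p)) //= big1 ?addr0 => [|x ne];
  rewrite pelt_nil [LHS]pmulZr pmulUU /pmul_basis pcat_nil ?eqxx //.
by rewrite (negPf ne) /= scaler0.
Qed.

Lemma emb0_pelt s x t : emb0 s * pelt x t = s x *: pelt x t.
Proof.
rewrite /pelt; case: insubP => [p _ pE|_] /=; last by rewrite mulr0 scaler0.
by rewrite emb0_basis /pstart pE.
Qed.

Lemma pelt_emb0 s x t : pelt x t * emb0 s = s (last x t) *: pelt x t.
Proof.
rewrite /pelt; case: insubP => [p _ pE|_] /=; last by rewrite mul0r scaler0.
by rewrite basis_emb0 /pend /pstart /ptail pE.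
Qed.

End PathAlgebra.

Section QuotientRing.
Variables (R : pzRingType) (X : set R).

Definition two_sided_ideal (I : set R) : Prop :=
  [/\ I 0, (forall x y, I x -> I y -> I (x - y)),
      (forall a x, I x -> I (a * x)) & (forall a x, I x -> I (x * a))].

Definition ideal_gen : set R := smallest two_sided_ideal X.

Lemma ideal_genP : two_sided_ideal ideal_gen.
Proof.
split=> [I [[]]//|x y hx hy I hI|a x hx I hI|a x hx I hI];
  have [[_ hB hl hr] _] := hI.
- by apply: hB; [apply: hx|apply: hy].
- by apply: hl; apply: hx.
- by apply: hr; apply: hx.
Qed.

Definition ideal_pred : {pred R} := fun x => `[< ideal_gen x >].

Lemma ideal_pred_zmod : zmod_closed ideal_pred.
Proof.
case: ideal_genP => h0 hB _ _; split; first by apply/asboolP.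
by move=> x y /asboolP hx /asboolP hy; apply/asboolP; apply: hB.
Qed.
HB.instance Definition _ := GRing.isZmodClosed.Build R ideal_pred ideal_pred_zmod.

Definition quotring : Type := Quotient.quot ideal_pred.
HB.instance Definition _ := GRing.Zmodule.on quotring.

Definition qpi (x : R) : quotring := (\pi_(Quotient.quot ideal_pred) x)%qT.

Lemma qpi_eq x y : qpi x = qpi y <-> ideal_gen (x - y).
Proof.
split=> [/eqP|h]; first by rewrite -Quotient.idealrBE => /asboolP.
by apply/eqP; rewrite -Quotient.idealrBE; apply/asboolP.
Qed.

Lemma qpi_surj (a : quotring) : exists x, a = qpi x.
Proof. by exists (repr a); rewrite /qpi reprK. Qed.

Lemma qpiB : {morph qpi : x y / x - y}.
Proof. exact: raddfB. Qed.
HB.instance Definition _ := GRing.isZmodMorphism.Build R quotring qpi qpiB.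

Definition qone : quotring := qpi 1.
Definition qmul (a b : quotring) : quotring := qpi (repr a * repr b).

Lemma qpiM x y : qmul (qpi x) (qpi y) = qpi (x * y).
Proof.
case: ideal_genP => _ hB hl hr; apply/qpi_eq.
have h z : ideal_gen (repr (qpi z) - z) by apply/qpi_eq; rewrite /qpi reprK.
set x' := repr _; set y' := repr _.
have -> : x' * y' - x * y = (x' - x) * y' - x * (y - y').
  by rewrite mulrBl mulrBr opprB addrA subrK.
apply: (hB); first by apply: hr; apply: h.
apply: hl; rewrite -opprB -sub0r; apply: hB; last exact: h.
by case: ideal_genP.
Qed.

Lemma qmulA : associative qmul.
Proof.
move=> a b c; have [x ->] := qpi_surj a; have [y ->] := qpi_surj b.
have [z ->] := qpi_surj c.
by rewrite !qpiM mulrA.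
Qed.
Lemma qmul1l : left_id qone qmul.
Proof. by move=> a; have [x ->] := qpi_surj a; rewrite qpiM mul1r. Qed.
Lemma qmul1r : right_id qone qmul.
Proof. by move=> a; have [x ->] := qpi_surj a; rewrite qpiM mulr1. Qed.
Lemma qmulDl : left_distributive qmul +%R.
Proof.
move=> a b c; have [x ->] := qpi_surj a; have [y ->] := qpi_surj b.
have [z ->] := qpi_surj c.
by rewrite -raddfD !qpiM mulrDl raddfD.
Qed.
Lemma qmulDr : right_distributive qmul +%R.
Proof.
move=> a b c; have [x ->] := qpi_surj a; have [y ->] := qpi_surj b.
have [z ->] := qpi_surj c.
by rewrite -raddfD !qpiM mulrDr raddfD.
Qed.
HB.instance Definition _ :=
  GRing.Zmodule_isPzRing.Build quotring qmulA qmul1l qmul1r qmulDl qmulDr.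

Lemma qpi_monoid : monoid_morphism qpi.
Proof. by split=> // x y; rewrite -qpiM. Qed.
HB.instance Definition _ := GRing.isMonoidMorphism.Build R quotring qpi qpi_monoid.

End QuotientRing.

Section Grading.
Variables (K : fieldType) (G : digraph) (X : set (pathalg K G)).
Local Notation A := (quotring X).

Definition gr (n : nat) : set A := @qpi _ X @` homog n.

(* The sum of the homogeneous components of degree less than n. *)
Definition gr_lt (n : nat) : set A := @qpi _ X @` supported (ltn^~ n).

Definition qelt (x : G) (s : seq G) : A := qpi X (pelt K x s).

Definition qemb0 (s : {ffun G -> K}) : A := qpi X (emb0 s).

Lemma gr0 n : gr n 0.
Proof. by exists 0; [apply: supported0|apply: raddf0]. Qed.

Lemma grD n a b : gr n a -> gr n b -> gr n (a + b).
Proof.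
move=> [f hf <-] [g hg <-]; exists (f + g); first exact: supportedD.
by rewrite raddfD.
Qed.

Lemma grN n a : gr n a -> gr n (- a).
Proof.
by move=> [f hf <-]; exists (- f); [apply: supportedN|rewrite raddfN].
Qed.

Lemma grM m n a b : gr m a -> gr n b -> gr (m + n) (a * b).
Proof.
move=> [f hf <-] [g hg <-]; exists (f * g); last by rewrite rmorphM.
by apply: supportedM hf hg => i j /eqP -> /eqP ->; apply/eqP.
Qed.

Lemma gr_qelt x s : gr (size s) (qelt x s).
Proof. by exists (pelt K x s) => //; apply: supported_pelt => /=. Qed.

Lemma gr_qemb0 s : gr 0 (qemb0 s).
Proof. by exists (emb0 s) => //; apply: supported_emb0. Qed.

Lemma gr_lt0 : gr_lt 0 0.
Proof. by exists 0; [apply: supported0|apply: raddf0]. Qed.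

Lemma gr_ltD m n a b : gr_lt m a -> gr_lt n b -> gr_lt (maxn m n) (a + b).
Proof.
move=> [f hf <-] [g hg <-]; exists (f + g); last by rewrite raddfD.
apply: supportedD => p; first by move/hf => /=; rewrite leq_max => ->.
by move/hg => /=; rewrite leq_max => ->; rewrite orbT.
Qed.

Lemma gr_ltM m n a b : gr_lt m a -> gr_lt n b -> gr_lt (m + n) (a * b).
Proof.
move=> [f hf <-] [g hg <-]; exists (f * g); last by rewrite rmorphM.
apply: supportedM hf hg => i j /= im jn.
by rewrite -addSn leq_add // ltnW.
Qed.

Lemma gr_lt_ex a : exists n, gr_lt n a.
Proof.
by have [f ->] := qpi_surj a; have [n fn] := supported_ltn f; exists n, f.
Qed.

Lemma gr_lt_sum n (I : Type) (s : seq I) (Q : pred I) (F : I -> A) :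
  (forall i, Q i -> gr_lt n (F i)) -> gr_lt n (\sum_(i <- s | Q i) F i).
Proof.
move=> h; elim/big_ind: _ => //; last by move=> a b /gr_ltD/[apply]; rewrite maxnn.
by exists 0; [apply: supported0|apply: raddf0].
Qed.

Definition gr_pred n : {pred A} := fun a => `[< gr n a >].

Lemma gr_pred_zmod n : zmod_closed (gr_pred n).
Proof.
split; first by apply/asboolP; apply: gr0.
move=> a b /asboolP ha /asboolP hb; apply/asboolP.
by apply: grD => //; apply: grN.
Qed.
HB.instance Definition _ n := GRing.isZmodClosed.Build A (gr_pred n) (gr_pred_zmod n).

Record grpart (n : nat) := GrPart { grval :> A; grvalP : grval \in gr_pred n }.
HB.instance Definition _ n := [isSub for @grval n].
HB.instance Definition _ n := [Choice of grpart n by <:].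
HB.instance Definition _ n := [SubChoice_isSubZmodule of grpart n by <:].

Lemma grpartM m n k (a : grpart m) b :
  (m + n = k)%N -> gr n b -> grval a * b \in gr_pred k.
Proof. by move=> <- hb; apply/asboolP/grM => //; apply/asboolP/grvalP. Qed.

Definition grscale n (a : grpart n) (s : {ffun G -> K}) : grpart n :=
  GrPart (grpartM a (addn0 n) (gr_qemb0 s)).

Definition grmul_arrow n (a : grpart n) (x y : G) : grpart n.+1 :=
  GrPart (grpartM a (addn1 n) (gr_qelt x [:: y])).

End Grading.

(* The quiver Q is a digraph, and I is the two-sided ideal generated by X; the
   quadratic case is [X `<=` homog 2].  An arrow of Q is a pair e = (x, y) with
   [arrow x y], and e^op is the path (y, x) of [opdigraph G]. *)
Section Koszul.
Variables (K : fieldType) (G : digraph) (X : set (pathalg K G)).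
Local Notation KG := (pathalg K G).
Local Notation KGop := (pathalg K (opdigraph G)).
Local Notation A := (quotring X).

Definition quad_rel : set KG := ideal_gen X `&` homog 2.

(* The form <p, q> = delta_(p^op, q), extended bilinearly. *)
Definition pairing (f : KG) (g : KGop) : K :=
  \sum_(p <- msupp f) f@_p * g@_(pop p).

Definition quad_perp : set KGop :=
  [set g | homog 2 g /\ forall f, quad_rel f -> pairing f g = 0].

Local Notation A' := (quotring quad_perp).
Local Notation A'_ := (grpart quad_perp).

Definition is_Shom n (phi : A'_ n -> A) : Prop :=
  (forall a b, phi (a + b) = phi a + phi b) /\
  (forall a s, phi (grscale a s) = phi a * qemb0 X s).

(* The graded Hom consists of the finite sums of homogeneous homomorphisms,
   i.e. of those with values in the sum of A_0, ..., A_(N-1) for some N.  The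
   A-module structure is (c phi)(a) = c (phi a). *)
Definition koszul_pred n : {pred A'_ n -> A^o} :=
  fun phi => `[< is_Shom phi /\ exists N, forall a, gr_lt N (phi a : A) >].

Lemma koszul_pred_submod n : submod_closed (@koszul_pred n).
Proof.
split.
  apply/asboolP; split; last by exists 0%N => a; apply: gr_lt0.
  by split=> [a b|a s]; rewrite /GRing.zero /= ?addr0 ?mul0r.
move=> c f g /asboolP [[fD fS] [N fN]] /asboolP [[gD gS] [M gM]]; apply/asboolP.
split; first split=> [a b|a s].
- rewrite /GRing.add /GRing.scale /= /GRing.scale /= fD gD mulrDr.
  by rewrite addrACA.
- rewrite /GRing.add /GRing.scale /= /GRing.scale /= fS gS mulrDl.
  by rewrite mulrA.
have [L cL] := gr_lt_ex c.
exists (maxn (L + N) M) => a; apply: gr_ltD => //; exact: gr_ltM.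
Qed.
HB.instance Definition _ n :=
  GRing.isSubmodClosed.Build A (A'_ n -> A^o) (@koszul_pred n) (@koszul_pred_submod n).

Record koszul n := KoszulHom {
  koszul_fun :> A'_ n -> A^o;
  koszul_funP : koszul_fun \in @koszul_pred n }.
HB.instance Definition _ n := [isSub for @koszul_fun n].
HB.instance Definition _ n := [Choice of koszul n by <:].
HB.instance Definition _ n := [SubChoice_isSubLmodule of koszul n by <:].

Definition koszul_diff_fun n (phi : koszul n.+1) : A'_ n -> A^o :=
  fun a => \sum_(e : G * G | arrow e.1 e.2)
    (phi (grmul_arrow a e.2 e.1) : A) * qelt X e.1 [:: e.2].

Lemma koszul_diff_subproof n (phi : koszul n.+1) :
  koszul_diff_fun phi \in @koszul_pred n.
Proof.
have /asboolP[[fD fS] [N fN]] := koszul_funP phi.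
apply/asboolP; split; first split=> [a b|a s].
- rewrite -big_split; apply: eq_bigr => e _ /=.
  rewrite -[RHS]mulrDl -fD; congr (phi _ * _); apply: val_inj => /=.
  by rewrite mulrDl.
- rewrite mulr_suml; apply: eq_bigr => e _ /=.
  pose c : {ffun G -> K} := [ffun=> s e.2].
  have -> : grmul_arrow (grscale a s) e.2 e.1 =
            grscale (grmul_arrow a e.2 e.1) (c : {ffun opdigraph G -> K}).
    apply: val_inj => /=; rewrite -!mulrA; congr (_ * _).
    rewrite -!rmorphM emb0_pelt pelt_emb0 /= ffunE //.
  rewrite fS -!mulrA; congr (_ * _).
  by rewrite -!rmorphM emb0_pelt pelt_emb0 /= ffunE.
exists (N + 2)%N => a; apply: gr_lt_sum => e _; apply: gr_ltM => //.
by exists (pelt K e.1 [:: e.2]) => //; apply: supported_pelt.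
Qed.

Definition koszul_diff n (phi : koszul n.+1) : koszul n :=
  KoszulHom (koszul_diff_subproof phi).

Lemma koszul_diff_linear n : linear (@koszul_diff n).
Proof.
move=> c f g; apply: val_inj; apply/funext => a /=.
rewrite /koszul_diff_fun /= -[RHS]/(c * _ + _) mulr_sumr -big_split /=.
by apply: eq_bigr => e _; rewrite mulrA -[RHS]mulrDl.
Qed.
HB.instance Definition _ n :=
  GRing.isLinear.Build A (koszul n.+1) (koszul n) *:%R (@koszul_diff n)
    (@koszul_diff_linear n).

(* (K_n)_m, where (K_n)_(n + i) = Hom_S(A^!_n, A_i) *)
Definition koszul_deg n (m : nat) : set (koszul n) :=
  [set phi | if (n <= m)%N then forall a, gr (m - n) (phi a : A) else phi = 0].

End Koszul.

(* Only the terms C_n with n >= 0 are stored, those with n < 0 being zero;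
   [mdeg n m] is the homogeneous component of [mobj n] of internal degree [m]. *)
Record gr_seq (A : pzRingType) := GrSeq {
  mobj :> nat -> lmodType A;
  mdeg : forall n, nat -> set (mobj n);
  mdiff : forall n, {linear mobj n.+1 -> mobj n} }.
Arguments mdeg {A} g n m.
Arguments mdiff {A} g n.

Definition is_chain_complex (A : pzRingType) (C : gr_seq A) : Prop :=
  (forall n m c, mdeg C n.+1 m c -> mdeg C n m (mdiff C n c)) /\
  (forall n c, mdiff C n (mdiff C n.+1 c) = 0).

Definition chain_isomorphic (A : pzRingType) (C D : gr_seq A) : Prop :=
  exists F : forall n, {linear C n -> D n},
    [/\ (forall n, bijective (F n)),
        (forall n m c, mdeg C n m c <-> mdeg D n m (F n c))
      & (forall n c, F n (mdiff C n c) = mdiff D n (F n.+1 c))].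

Definition koszul_complex (K : fieldType) (G : digraph) (X : set (pathalg K G)) :
    gr_seq (quotring X) :=
  @GrSeq (quotring X) (koszul X) (@koszul_deg K G X) (@koszul_diff K G X).

Section KG.
Variables (K : fieldType) (G : digraph).

Definition tsum (x y : G) : pathalg K G :=
  \sum_(v : G | arrow x v && arrow v y) pelt K x [:: v; y].

Definition trel : set (pathalg K G) :=
  [set t | exists x y, dist x y = Some 2 /\ t = tsum x y].

Lemma trel_homog : trel `<=` homog 2.
Proof.
move=> t [x [y [_ ->]]]; apply: supported_sum => v _.
exact: supported_pelt.
Qed.

(* Only the ring structure is recorded: K acts through its image in the degree
   zero part. *)
Definition Omega : pzRingType := quotring trel.

(* An element of [KG n], the direct sum of the left ideals Omega e_x over the
   pairs with d(x,y) = n, is the family of its components. *)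
Definition dpair (n : nat) := {xy : G * G | dist xy.1 xy.2 == Some n}.

Definition KG_pred n : {pred {ffun dpair n -> Omega^o}} :=
  fun f => `[< forall i : dpair n,
                 exists a : Omega, f i = a * qelt trel (val i).1 [::] >].

Lemma KG_pred_submod n : submod_closed (@KG_pred n).
Proof.
split; first by apply/asboolP => i; exists 0; rewrite ffunE mul0r.
move=> c f g /asboolP hf /asboolP hg; apply/asboolP => i.
have [[a fa] [b gb]] := (hf i, hg i).
exists (c * a + b); rewrite !ffunE fa gb mulrDl -mulrA //.
Qed.
HB.instance Definition _ n :=
  GRing.isSubmodClosed.Build Omega {ffun dpair n -> Omega^o} (@KG_pred n)
    (@KG_pred_submod n).

Record KG n := KGElt {
  KGval : {ffun dpair n -> Omega^o};
  KGvalP : KGval \in @KG_pred n }.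
HB.instance Definition _ n := [isSub for @KGval n].
HB.instance Definition _ n := [Choice of KG n by <:].
HB.instance Definition _ n := [SubChoice_isSubLmodule of KG n by <:].

(* This is 0 unless d(x,y) = n. *)
Definition kappa_val n (x y : G) : {ffun dpair n -> Omega^o} :=
  [ffun i => if val i == (x, y) then qelt trel x [::] else 0].

Lemma kappa_subproof n x y : kappa_val n x y \in @KG_pred n.
Proof.
apply/asboolP => i; rewrite ffunE.
case: eqP => [->|_]; last by exists 0; rewrite mul0r.
by exists 1; rewrite mul1r.
Qed.
Definition kappa n (x y : G) : KG n := KGElt (kappa_subproof n x y).

(* The component of degree m, kappa_(x,y) being of degree n. *)
Definition KG_deg n (m : nat) : set (KG n) :=
  [set f | if (n <= m)%N then forall i, gr (m - n) (KGval f i : quotring trel) else f = 0].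

Definition KG_diff_spec (d : forall n, {linear KG n.+1 -> KG n}) : Prop :=
  forall n x y, dist x y = Some n.+1 ->
    d n (kappa n.+1 x y) =
      \sum_(v : G | (dist x v == Some 1%N) && (dist v y == Some n))
         (qelt trel x [:: v] : Omega) *: kappa n v y.

Definition KG_seq (d : forall n, {linear KG n.+1 -> KG n}) : gr_seq Omega :=
  @GrSeq Omega KG KG_deg d.

End KG.

(* Main.v *)
Require Import Defs.
From HB Require Import structures.
From mathcomp Require Import all_boot all_algebra.
From mathcomp Require Import finmap.
From mathcomp Require Import boolp classical_sets functions.
From mathcomp.multinomials Require Import monalg.

(** Let [A] be the path cochain algebra and [B] its quadratic dual. The degree 2
    part of the ideal [T] is spanned by the sums [t_(x,y)] with [d(x, y) = 2], so
    its orthogonal complement consists of the combinations of reversed paths of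
    length 2 whose coefficients add up to zero over each pair at distance 2
    ([quad_perpP]). Hence [B] is the opposite path algebra in which a path of
    length 2 that is not shortest is zero and two shortest ones with the same ends
    are equal. In other words, [B] is generated by reversed paths up to the
    2-short congruence, the paths with a long subpath of length 2 being zero.

    This makes the component [B_n] a free [K]-module on the pairs [(x, y)] with
    [d(x, y) = n]. The classes of geodesics are independent because, for such a
    pair, the number of geodesics from [x] to [y] counted with coefficients is a
    linear form vanishing on the dual ideal ([pform_ends_ideal]): an infix of a
    geodesic is a geodesic. They span because, under [V2], shortest paths with the
    same ends are congruent and long paths are congruent to reducible ones
    ([dual_expansionP]).

    A right [S]-linear map from [B_n] to [A] is then determined by its values on
    the geodesic classes, and the value at the reverse of a path from [x] to [y]
    is an arbitrary element of [A e_x]. This is the isomorphism [to_koszul] between the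
    direct sum of the [A e_x] and the term of the Koszul complex
    ([to_koszulK], [of_koszulK]). In [B] the product of the geodesic class of
    [(x, y)] by the reversed arrow [(u, x)] is the class of [(u, y)] if
    [d(u, y) = n.+1] and zero otherwise, so the Koszul differential becomes the
    differential prescribed on the generators ([to_koszul_diff]).

    That the latter squares to zero is seen directly: the component of its square
    from [(x, y)] to [(z, y)] is the sum over all the paths of length 2 from [x] to
    [z], that is, the relation [t_(x,z)] ([sum_two_steps]). *)

Set Implicit Arguments.
Unset Strict Implicit.
Unset Printing Implicit Defensive.

Import GRing.Theory.
Local Open Scope ring_scope.

(** * Distances and geodesics *)

Section Distance.
Variable G : digraph.
Implicit Types (x y u v : G) (s : seq G) (p q r : gpath G).

Lemma has_pathP x y n :
  reflect (exists s, [/\ path (@arrow G) x s, last x s = y & size s = n])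
          (has_path x y n).
Proof.
apply: (iffP (asboolP _)) => [[p [<- <- <-]]|[s [h e1 e2]]].
  by exists (ptail p); split=> //; apply: gpvalP.
by exists (@GPath G (x, s) h).
Qed.

Lemma distP x y n : dist x y = Some n <->
  has_path x y n /\ forall s, path (@arrow G) x s -> last x s = y -> (n <= size s)%N.
Proof.
rewrite /dist; case: pselect => [ex|nex]; last first.
  by split=> // -[h _]; case: nex; exists n.
case: ex_minnP => m hm min_m; split=> [[<-]|[hn min_n]].
  by split=> // s hs es; apply: min_m; apply/has_pathP; exists s.
congr Some; apply/eqP; rewrite eqn_leq min_m //=.
by case/has_pathP: hm => s [hs es <-]; apply: min_n.
Qed.

Lemma dist_arrow x y : (dist x y == Some 1%N) = arrow x y.
Proof.
apply/eqP/idP => [/distP[/has_pathP[s [hs <- sn]] _]|h].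
  by case: s sn hs => [|v [|? ?]] //= _ /andP[].
apply/distP; split; first by apply/has_pathP; exists [:: y]; rewrite /= h.
by case=> //= _ exy; move: h; rewrite exy arrow_irr.
Qed.

(** Replacing the middle part of a geodesic by a shorter path would shorten
    the whole. *)
Lemma dist_infix x s1 s2 s3 :
  path (@arrow G) x (s1 ++ s2 ++ s3) ->
  dist x (last x (s1 ++ s2 ++ s3)) = Some (size (s1 ++ s2 ++ s3)) ->
  dist (last x s1) (last x (s1 ++ s2)) = Some (size s2).
Proof.
rewrite !cat_path !last_cat => /and3P[h1 h2 h3] /distP[_ hmin].
apply/distP; split; first by apply/has_pathP; exists s2.
move=> t ht et; have := hmin (s1 ++ t ++ s3).
by rewrite !cat_path !last_cat h1 ht et h3 !size_cat leq_add2l leq_add2r; apply.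
Qed.

(** Continuing [x -> v -> z] by a geodesic from [z] to [y] gives a path of length
    [n.+2], hence a geodesic, and the two distances are read off its infixes. *)
Lemma dist_two_steps x v z y n :
  arrow x v -> arrow v z -> dist x y = Some n.+2 -> dist z y = Some n ->
  dist v y = Some n.+1 /\ dist x z = Some 2%N.
Proof.
move=> a1 a2 dx /distP[/has_pathP[s [hs es sn]] _].
have hp : path (@arrow G) x [:: v, z & s] by rewrite /= a1 a2.
have hd : dist x (last x [:: v, z & s]) = Some (size [:: v, z & s]).
  by rewrite /= es sn.
split.
  have := @dist_infix x [:: v] (z :: s) [::].
  by rewrite cats0 /= es sn; apply=> //; rewrite -es -sn.
exact: (@dist_infix x [::] [:: v; z] s).
Qed.

Lemma shortest_middle p q r :
  pend p = pstart q -> pend q = pstart r ->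
  dist (pstart p) (pend r) = Some (plen p + plen q + plen r)%N -> shortest q.
Proof.
case: p q r => -[x s] /= hs [[y t] /= ht] [[z u] /= hu].
rewrite /shortest /pend /pstart /plen /ptail /= => ey ez d.
have := @dist_infix x s t u.
rewrite !cat_path !last_cat ey ez hs ht hu !size_cat addnA; exact.
Qed.

Lemma long_gt1 p : long p -> (1 < plen p)%N.
Proof.
case: p => -[x [|y [|z s]]] hp //= []; rewrite /shortest /pstart /pend /plen /=.
  by apply/distP; split=> //; apply/has_pathP; exists [::].
by apply/eqP; rewrite dist_arrow; move: hp => /=; rewrite andbT.
Qed.

Lemma plen0_end p : plen p = 0%N -> p = pnil (pend p).
Proof. by case: p => -[x [|//]] hp _; apply: val_inj. Qed.

Lemma plen0_start p : plen p = 0%N -> p = pnil (pstart p).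
Proof. by case: p => -[x [|//]] hp _; apply: val_inj. Qed.

Lemma pcat_None p q : pcat p q = None ->
  (pend p == pstart q) = false.
Proof. by case: eqP => // /pcat_def[r ->]. Qed.

Lemma subpath_cat p q : subpath q p ->
  exists a b, obind (pcat^~ b) (pcat a q) = Some p.
Proof.
case/infixP => s1 [s2 e].
have hp : path (@arrow G) (pstart p) (ptail p) by exact: gpvalP.
have hb : path (@arrow G) (pend q) s2.
  case: s1 e => [|x s1] /= [e1 e2]; move: hp; rewrite e2.
    by rewrite cat_path e1 => /andP[].
  by rewrite cat_path /= cat_path => /and4P[].
have [a [ha ea]] : exists a : gpath G, gpval a = (pstart p, behead (rcons s1 (pstart q)))
    /\ pend a = pstart q.
  case: s1 e => [|x s1] /= [e1 e2].
    by exists (pnil (pstart q)); rewrite -e1.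
  have ha : path (@arrow G) (pstart p) (rcons s1 (pstart q)).
    by move: hp; rewrite e2 -cat_rcons cat_path => /andP[].
  exists (@GPath G (pstart p, rcons s1 (pstart q)) ha); split=> //.
  by rewrite /pend /pstart /ptail /= last_rcons.
exists a, (@GPath G (pend q, s2) hb).
have [t et] := pcat_def ea.
rewrite et /=; apply/pcatP; split; first by rewrite (pcat_end et).
case/pcatP: et => _ te; rewrite [pstart t]/pstart [ptail t]/ptail te /=.
rewrite [pstart a]/pstart [ptail a]/ptail ha /=.
case: p e {hp ha} => -[x s] hp; rewrite /pverts /pstart /ptail /=.
by case: s1 => [|z s1] /= [-> ->] //; rewrite -cat_rcons catA.
Qed.

Lemma pend_pop p : pend (pop p) = pstart p.
Proof.
rewrite /pend /pstart /ptail /=; case: p => -[x [|y s]] hp //=.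
by rewrite rev_cons last_rcons.
Qed.

Lemma pstart_pop p : pstart (pop p) = pend p. Proof. by []. Qed.

Lemma plen_pop p : plen (pop p) = plen p.
Proof. by rewrite /plen /ptail /= size_rev size_belast. Qed.

Lemma pop_surj (r : gpath (opdigraph G)) : exists p : gpath G, pop p = r.
Proof.
case: r => -[y s] hs.
have h : path (@arrow G) (last y s) (rev (belast y s)).
  exact: etrans (rev_path (@arrow G) y s) hs.
exists (@GPath G (last y s, rev (belast y s)) h); apply: val_inj => /=.
rewrite /pend /pstart /ptail /=; case/lastP: s {hs h} => [|s z] //.
rewrite last_rcons belast_rcons rev_cons last_rcons belast_rcons /= rev_cons revK.
by [].
Qed.

Lemma pop_inj : injective (@pop G).
Proof.
case=> -[x s] hs [[y t] ht] /(congr1 (@gpval _)).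
rewrite /= /pend /pstart /ptail /= => -[el /(congr1 rev)]; rewrite !revK => eb.
apply: val_inj => /=.
have : rcons (belast x s) (last x s) = rcons (belast y t) (last y t) by rewrite el eb.
by rewrite -!lastI => -[-> ->].
Qed.

Lemma pcat_pop p q r : pcat p q = Some r -> pcat (pop q) (pop p) = Some (pop r).
Proof.
case/pcatP=> e rE; apply/pcatP; rewrite pend_pop pstart_pop; split=> //.
rewrite /= /pend /pstart /ptail rE /=; move: e; rewrite /pend /pstart /ptail => e.
by rewrite last_cat belast_cat rev_cat e.
Qed.

Lemma dpair_eqE n (i j : dpair G n) :
  ((val i).1 == (val j).1) && ((val i).2 == (val j).2) = (i == j).
Proof.
rewrite -[RHS](inj_eq val_inj); case: (val i) (val j) => [x y] [u v].
by rewrite xpair_eqE.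
Qed.

Lemma geodesic_ex n (i : dpair G n) :
  exists p : gpath G, [/\ pstart p = (val i).1, pend p = (val i).2 & plen p = n].
Proof.
by case: i => -[x y] /= /eqP/distP[/asboolP[p hp] _]; exists p.
Qed.

(** A choice of one geodesic for each pair; under [V2] any two choices agree in
    the dual algebra. *)
Definition geodesic n (i : dpair G n) : gpath G := projT1 (cid (geodesic_ex i)).

Lemma geodesicP n (i : dpair G n) :
  [/\ pstart (geodesic i) = (val i).1, pend (geodesic i) = (val i).2
    & plen (geodesic i) = n].
Proof. exact: projT2 (cid (geodesic_ex i)). Qed.

End Distance.

(** * Linear forms on the path algebra *)

Section LinearForms.
Variables (K : fieldType) (G : digraph).
Local Notation KG := (pathalg K G).
Local Notation pb := (@pbasis K G).
Implicit Types (w : gpath G -> K) (f g : KG) (p q r : gpath G).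

(** The linear form on the path algebra with prescribed values on paths. *)
Definition pform w (f : KG) : K := mmap idfun w f.

Lemma pformD w : {morph pform w : f g / f + g}.
Proof. by move=> f g; apply: mmapD. Qed.

Lemma pformB w : {morph pform w : f g / f - g}.
Proof. by move=> f g; apply: mmapB. Qed.

Lemma pform0 w : pform w 0 = 0.
Proof. exact: mmap0. Qed.

Lemma pformZ w c f : pform w (c *: f) = c * pform w f.
Proof.
rewrite /pform (mmapEw (msuppZ_le c f)) mmapE mulr_sumr.
by apply: eq_bigr => p _; rewrite mcoeffZ mulrA.
Qed.

Lemma mcoeff_basis p q : (pb p)@_q = (p == q)%:R.
Proof. by rewrite pbasis.unlock mcoeffU. Qed.

Lemma pform_basis w p : pform w (pb p) = w p.
Proof. by rewrite pbasis.unlock /pform mmapU mul1r. Qed.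

Lemma pform_sum w (I : Type) (s : seq I) (P : pred I) (F : I -> KG) :
  pform w (\sum_(i <- s | P i) F i) = \sum_(i <- s | P i) pform w (F i).
Proof. exact: (big_morph _ (pformD w) (pform0 w)). Qed.

Lemma pform_pelt w x s : pform w (pelt K x s) = oapp w 0 (insub (x, s)).
Proof.
by rewrite /pelt; case: insub => [p|] /=; rewrite ?pform_basis ?pform0.
Qed.

Lemma eq_pform_homog n w w' f : homog n f ->
  (forall p, plen p = n -> w p = w' p) -> pform w f = pform w' f.
Proof.
move=> hf e; rewrite /pform !mmapE big_seq [RHS]big_seq; apply: eq_bigr => p pf.
by rewrite e //; apply/eqP; apply: (hf p); rewrite mcoeff_neq0.
Qed.

Lemma homog_ind n (P : KG -> Prop) :
  P 0 -> (forall f g, P f -> P g -> P (f + g)) -> (forall c f, P f -> P (c *: f)) ->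
  (forall p, plen p = n -> P (pb p)) -> forall f, homog n f -> P f.
Proof.
move=> P0 PD PZ PU f hf; rewrite [f]palgE big_seq.
apply: (big_ind P) => // p pf; apply: PZ; apply: PU.
by apply/eqP; apply: (hf p); rewrite mcoeff_neq0.
Qed.

(** Multiplying by paths on both sides is dual to precomposing the values of
    the form with concatenation. *)
Lemma pform_sandwich w p f q : pform w (pb p * f * pb q) =
  pform (fun r => oapp w 0 (obind (pcat^~ q) (pcat p r))) f.
Proof.
elim/palg_ind: f => [|f g hf hg|c f hf|r].
- by rewrite mulr0 mul0r !pform0.
- by rewrite mulrDr mulrDl !pformD hf hg.
- by rewrite -pscalerAr -pscalerAl !pformZ hf.
rewrite pbasisM /pmul_basis pform_basis; case: (pcat p r) => [t|] /=.
  by rewrite pbasisM /pmul_basis; case: (pcat t q) => [u|] /=; rewrite ?pform_basis ?pform0.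
by rewrite mul0r pform0.
Qed.

(** The elements [f] with [w(a f b) = 0] for all [a] and [b] form a two-sided
    ideal on which [w] vanishes; by linearity it is enough to test paths. *)
Lemma pform_ideal (X : set KG) w :
  (forall p q x, X x -> pform w (pb p * x * pb q) = 0) ->
  forall f, ideal_gen X f -> pform w f = 0.
Proof.
move=> hX f hf.
have : [set g | forall a b, pform w (a * g * b) = 0]%classic f.
  apply: hf; split.
    split=> /= [a b|x y hx hy a b|c x hx a b|c x hx a b].
    - by rewrite mulr0 mul0r pform0.
    - by rewrite mulrBr mulrBl pformB hx hy subrr.
    - by rewrite mulrA hx.
    - by rewrite mulrA -mulrA hx.
  move=> x Xx /= a b; elim/palg_ind: a => [|a a' ha ha'|c a ha|p].
  - by rewrite !mul0r pform0.
  - by rewrite !mulrDl pformD ha ha' addr0.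
  - by rewrite -!pscalerAl pformZ ha mulr0.
  elim/palg_ind: b => [|b b' hb hb'|c b hb|q].
  - by rewrite mulr0 pform0.
  - by rewrite mulrDr pformD hb hb' addr0.
  - by rewrite -pscalerAr pformZ hb mulr0.
  exact: hX.
by move/(_ 1 1); rewrite mul1r mulr1.
Qed.

(** The quotient rings carry no scalar multiplication; scalars act through the
    constant functions of [S]. *)
Lemma pscale_emb0 (c : K) f : c *: f = f * emb0 [ffun=> c].
Proof.
elim/palg_ind: f => [|f g hf hg|d f hf|p].
- by rewrite scaler0 mul0r.
- by rewrite scalerDr hf hg mulrDl.
- by rewrite scalerA mulrC -scalerA hf pscalerAl.
by rewrite basis_emb0 ffunE.
Qed.

Lemma idealD (X : set KG) f g :
  ideal_gen X f -> ideal_gen X g -> ideal_gen X (f + g).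
Proof.
case: (ideal_genP X) => I0 IB _ _ hf hg.
have -> : f + g = f - (0 - g) by rewrite sub0r opprK.
by apply: (IB) => //; apply: IB.
Qed.

Lemma idealZ (X : set KG) c f : ideal_gen X f -> ideal_gen X (c *: f).
Proof. by rewrite pscale_emb0; case: (ideal_genP X) => _ _ _ h; apply: h. Qed.

End LinearForms.

(** * The quadratic dual of the path cochain algebra *)

Section QuadraticDual.
Variables (K : fieldType) (G : digraph).
Local Notation KG := (pathalg K G).
Local Notation KGop := (pathalg K (opdigraph G)).
Local Notation pb := (@pbasis K G).
Local Notation pbo := (@pbasis K (opdigraph G)).
Local Notation T := (@trel K G).
Local Notation dual_rel := (quad_perp T).
Implicit Types (x y : G) (p q : gpath G).

Lemma pform_tsum (w : gpath G -> K) x y : pform w (tsum K x y) =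
  \sum_(v : G | arrow x v && arrow v y) oapp w 0 (insub (x, [:: v; y])).
Proof. by rewrite pform_sum; apply: eq_bigr => v _; rewrite pform_pelt. Qed.

Lemma quad_rel_tsum x y : dist x y = Some 2%N -> quad_rel T (tsum K x y).
Proof.
move=> d; have t : T (tsum K x y) by exists x, y.
by split; [move=> I [_]; apply|apply: trel_homog].
Qed.

(** A form concentrated in degree 2 only sees the multiples of [t_(x,y)] by
    paths of length 0, so it kills the ideal once it kills each [t_(x,y)]: the
    degree 2 part of [T] is spanned by the [t_(x,y)]. *)
Lemma pform_trel (w : gpath G -> K) :
  (forall p, plen p != 2%N -> w p = 0) ->
  (forall x y, dist x y = Some 2%N -> pform w (tsum K x y) = 0) ->
  forall f, ideal_gen T f -> pform w f = 0.
Proof.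
move=> w2 wt; apply: pform_ideal => p q _ [x [y [d ->]]].
rewrite pform_sandwich.
have [e|ne] := eqVneq (pend p, pstart q, plen p, plen q) (x, y, 0%N, 0%N).
  case: e => ex ey lp lq; rewrite -[RHS](wt x y d) !pform_tsum.
  apply: eq_bigr => v _; case: insubP => [r _ rE|//] /=.
  have [er fr] : pstart r = x /\ pend r = y by rewrite /pend /pstart /ptail rE.
  rewrite (plen0_end lp) (plen0_start lq) pnil_cat ex er eqxx /= pcat_nil.
  by rewrite fr -ey eqxx.
rewrite pform_tsum big1 // => v _; case: insubP => [r _ rE|//] /=.
case e1: (pcat p r) => [t|] //=; case e2: (pcat t q) => [u|] //=.
apply: w2; apply: contra ne; rewrite (pcat_len e2) (pcat_len e1).
have -> : plen r = 2%N by rewrite /plen /ptail rE.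
case/pcatP: e1 (pcat_end e1) => -> _ tr; case/pcatP: e2 => <- _.
rewrite tr /pend /pstart /ptail rE /= addn2 !addSn !eqSS addn_eq0.
by case/andP => /eqP-> /eqP->; rewrite !eqxx.
Qed.

(** The only candidate for [v] is the middle vertex of [p]. *)
Lemma sum_length2_paths p x y : plen p = 2%N ->
  \sum_(v : G | arrow x v && arrow v y)
     oapp (fun r => (p == r)%:R) 0 (insub (x, [:: v; y])) =
  ((pstart p == x) && (pend p == y))%:R :> K.
Proof.
move=> p2; transitivity (\sum_(v : G | arrow x v && arrow v y)
    (gpval p == (x, [:: v; y]))%:R : K).
  by apply: eq_bigr => v axy; rewrite insubT /= ?andbT.
case: p p2 => -[a [|b [|c [|//]]]] // hp _.
rewrite /pend /pstart /ptail /=; move: hp => /= /and3P[ab bc _].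
case: andP => [[/eqP <- /eqP <-]|h].
  rewrite (bigD1 b) /= ?ab ?bc // eqxx big1 ?addr0 // => v /andP[_ nv].
  by case: eqP => // -[e]; rewrite e eqxx in nv.
by rewrite big1 // => v _; case: eqP => // -[e1 _ e2]; case: h; rewrite e1 e2 !eqxx.
Qed.

(** The form on the opposite path algebra counting the reverses of the paths of
    length [n] from [x] to [y]. For [n = 2] it is the pairing with [t_(x,y)], and for
    [n = d(x, y)] it is a coordinate on the dual algebra. *)
Definition ends n x y (r : gpath (opdigraph G)) : K :=
  [&& plen r == n, pend r == x & pstart r == y]%:R.

Lemma ends_pop n x y p :
  ends n x y (pop p) = [&& plen p == n, pstart p == x & pend p == y]%:R.
Proof. by rewrite /ends plen_pop pend_pop. Qed.

Lemma pform_tsum_dual (g : KGop) x y : homog 2 g ->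
  pform (fun p => g@_(pop p)) (tsum K x y) = pform (ends 2 x y) g.
Proof.
move=> g2; rewrite pform_tsum; move: g g2; apply: homog_ind.
- by rewrite pform0 big1 // => v _; case: insub => //= r; rewrite mcoeff0.
- move=> f g hf hg; rewrite pformD -hf -hg -big_split; apply: eq_bigr => v _ /=.
  by case: insub => [r|] /=; rewrite ?addr0 // mcoeffD.
- move=> c f hf; rewrite pformZ -hf mulr_sumr; apply: eq_bigr => v _ /=.
  by case: insub => [r|] /=; rewrite ?mulr0 // mcoeffZ.
move=> r r2; have [p pr] := pop_surj r; rewrite -pr in r2 *.
rewrite pform_basis ends_pop; rewrite plen_pop in r2.
rewrite r2 /= -sum_length2_paths //; apply: eq_bigr => v _.
by case: insub => //= q; rewrite mcoeff_basis (inj_eq (@pop_inj G)).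
Qed.

(** The relations of the dual algebra: the quadratic elements whose
    coefficients over each [(x, y)] at distance 2 add up to zero. *)
Lemma quad_perpP (g : KGop) : dual_rel g <->
  homog 2 g /\ forall x y, dist x y = Some 2%N -> pform (ends 2 x y) g = 0.
Proof.
split=> [[g2 gT]|[g2 gt]]; split=> //.
  by move=> x y d; rewrite -pform_tsum_dual //; apply/gT/quad_rel_tsum.
move=> f [Tf _]; apply: (pform_trel _ _ Tf) => [p np|x y d].
  by apply/eqP; apply: contraNT np => h; have := g2 _ h; rewrite /= plen_pop.
by rewrite pform_tsum_dual // gt.
Qed.

Lemma long2_perp p : long p -> plen p = 2%N -> dual_rel (pbo (pop p)).
Proof.
move=> lp p2; apply/quad_perpP; split=> [|x y d].
  by apply: supported_basis; rewrite /= plen_pop p2.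
rewrite pform_basis ends_pop; case: and3P => // -[_ /eqP ex /eqP ey].
by case: lp; rewrite /shortest p2 ex ey.
Qed.

Lemma connected2_perp p q : connect_same p q -> plen p = 2%N -> plen q = 2%N ->
  dual_rel (pbo (pop p) - pbo (pop q)).
Proof.
move=> [es ee] p2 q2; apply/quad_perpP; split=> [|x y d].
  by apply: supportedD; last apply: supportedN; apply: supported_basis;
    rewrite /= plen_pop ?p2 ?q2.
by rewrite pformB !pform_basis !ends_pop es ee p2 q2 subrr.
Qed.

(** Counting geodesics is well defined on the dual algebra. If some [a r b] is the
    reverse of a geodesic from [x] to [y], then [r] is that of one of length 2,
    and summing over all [r] with the same ends gives zero on a dual relation; if
    there is no such [r], every term vanishes. *)
Lemma pform_ends_ideal n x y : dist x y = Some n ->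
  forall f, ideal_gen dual_rel f -> pform (ends n x y) f = 0.
Proof.
move=> d; apply: pform_ideal => a b g /quad_perpP[g2 gt].
rewrite pform_sandwich.
pose C := [&& (plen a + plen b).+2 == n, pend b == x & pstart a == y].
have ge := eq_pform_homog (w' := fun r => if C then ends 2 (pstart b) (pend a) r else 0) g2.
rewrite {}ge => [|r r2]; last first.
  case e1: (pcat a r) => [t|] /=; last first.
    by rewrite /ends (eq_sym (pstart r)) (pcat_None e1) !andbF if_same.
  rewrite /ends -(pcat_end e1).
  case e2: (pcat t b) => [u|] /=; last by rewrite (pcat_None e2) andbF if_same.
  rewrite (pcat_len e2) (pcat_len e1) (pcat_end e2) (pcat_start e2) (pcat_start e1).
  case/pcatP: e1 => -> _; case/pcatP: e2 => -> _.
  by rewrite r2 !eqxx /= addnAC addn2 -/C; case: C.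
(* [C] collects the conditions on [a] and [b]; they do not involve [r]. *)
case hC: C; last by rewrite /pform mmapE big1 // => r _; rewrite mulr0.
case/and3P: hC => /eqP ln /eqP bx /eqP ay.
have [d2|] := eqVneq (@dist G (pstart b) (pend a)) (Some 2%N); first exact: gt.
move=> nd.
transitivity (pform (fun _ => 0) g); last first.
  by rewrite /pform mmapE big1 // => r _; rewrite mulr0.
apply: eq_pform_homog g2 _ => r r2; rewrite /ends.
case: and3P => // -[_ /eqP rb /eqP ra]; case/eqP: nd.
have [p pa] := pop_surj a; have [q qb] := pop_surj b; have [s sr] := pop_surj r.
rewrite -pa -qb -sr !pend_pop !pstart_pop !plen_pop in ra rb r2 bx ay ln *.
rewrite -rb -ra -r2; apply: (@shortest_middle G q s p) => //.
by rewrite bx ay d -ln r2 addnAC addn2 (addnC (plen p)).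
Qed.

Local Notation dual_ideal := (ideal_gen dual_rel).

Lemma pbo_cat p q r : pcat p q = Some r -> pbo (pop r) = pbo (pop q) * pbo (pop p).
Proof. by move=> /pcat_pop e; rewrite pbasisM /pmul_basis e. Qed.

(** Equality in the dual algebra is a congruence identifying shortest paths of
    length at most 2 with the same ends, so it contains the minimal one. *)
Lemma two_shortly_congruent_dual p q : two_shortly_congruent p q ->
  connect_same p q /\ dual_ideal (pbo (pop p) - pbo (pop q)).
Proof.
case: (ideal_genP dual_rel) => I0 IB Il Ir; move=> h.
pose R := [set pq : gpath G * gpath G | connect_same pq.1 pq.2 /\
  dual_ideal (pbo (pop pq.1) - pbo (pop pq.2))]%classic.
apply: (h R); split.
  split=> /=.
  - by move=> r; split=> //=; rewrite subrr.
  - move=> r s [[e1 e2] hI]; split=> //=.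
    by rewrite -opprB -sub0r; apply: IB.
  - move=> r s t [[e1 e2] h1] [[e3 e4] h2]; split; first by split; rewrite ?e1 ?e2.
    by rewrite /= -(subrKA (pbo (pop s))); apply: idealD.
  - by move=> r s; case.
  - move=> u u' a a' r r' [[/= es ee] hI].
    case e1: (pcat a u) => [t|] //= e2; case e3: (pcat a u') => [t'|] //= e4.
    split; first by split; rewrite /= ?(pcat_start e2) ?(pcat_start e4) ?(pcat_start e1)
      ?(pcat_start e3) ?(pcat_end e2) ?(pcat_end e4).
    rewrite /= (pbo_cat e2) (pbo_cat e4) (pbo_cat e1) (pbo_cat e3) -mulrBr -mulrBl.
    by apply: (Il); apply: Ir; apply: hI.
case=> p' q' [/= sp sq [es ee] [n dn n2]]; split=> //=.
have lp : plen p' = n by move: sp; rewrite /shortest dn => -[].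
have lq : plen q' = n by move: sq; rewrite /shortest -es -ee dn => -[].
(* In length at most 1, two paths with the same ends are equal. *)
move: n2; rewrite leq_eqVlt => /predU1P[en|].
  by move=> I hI; apply: hI.2; apply: connected2_perp; rewrite ?lp ?lq.
rewrite ltnS => n1; suff -> : p' = q' by rewrite subrr.
apply: val_inj; case: p' q' es ee lp lq {sp sq dn} => -[x s] hs [[y t] ht].
rewrite /pend /pstart /plen /ptail /= => <-.
move=> e sn; move: n1 e; rewrite -{n}sn.
by case: s hs => [|a [|//]] _ _; case: t ht => [|c [|//]] //= _ ->.
Qed.

Lemma dual_ideal_perp f : dual_rel f -> dual_ideal f.
Proof. by move=> h I [_]; apply. Qed.

(** A long subpath of length at most 2 has length exactly 2, and it is itself a
    dual relation. *)
Lemma two_reducible_dual p : two_reducible p -> dual_ideal (pbo (pop p)).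
Proof.
case: (ideal_genP dual_rel) => I0 IB Il Ir.
case=> _ [q [/subpath_cat[a [b]]]].
case e1: (pcat a q) => [t|] //= e2 lq q2.
rewrite (pbo_cat e2) (pbo_cat e1); apply: (Il); apply: Ir; apply: dual_ideal_perp.
by apply: long2_perp => //; apply/eqP; rewrite eqn_leq q2 long_gt1.
Qed.

(** The coordinate at the pair [i] of the geodesic basis of the dual algebra. *)
Definition dcoef n (i : dpair G n) (f : KGop) : K :=
  pform (ends n (val i).1 (val i).2) f.

Lemma dcoefD n (i : dpair G n) : {morph dcoef i : f g / f + g}.
Proof. exact: pformD. Qed.

Lemma dcoefZ n (i : dpair G n) c f : dcoef i (c *: f) = c * dcoef i f.
Proof. exact: pformZ. Qed.

Lemma dcoef0 n (i : dpair G n) : dcoef i 0 = 0.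
Proof. exact: pform0. Qed.

Lemma dcoef_pop n (i : dpair G n) p : dcoef i (pbo (pop p)) =
  [&& plen p == n, pstart p == (val i).1 & pend p == (val i).2]%:R.
Proof. by rewrite /dcoef pform_basis ends_pop. Qed.

Lemma dcoef_geodesic n (i j : dpair G n) :
  dcoef i (pbo (pop (geodesic j))) = (i == j)%:R.
Proof.
have [es ee el] := geodesicP j.
by rewrite dcoef_pop es ee el eqxx andTb dpair_eqE eq_sym.
Qed.

Definition dual_expansion n (f : KGop) : KGop :=
  \sum_(i : dpair G n) dcoef i f *: pbo (pop (geodesic i)).

Lemma dual_expansionD n f g :
  dual_expansion n (f + g) = dual_expansion n f + dual_expansion n g.
Proof.
by rewrite -big_split; apply: eq_bigr => i _; rewrite dcoefD scalerDl.
Qed.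

Lemma dual_expansionZ n c f : dual_expansion n (c *: f) = c *: dual_expansion n f.
Proof.
by rewrite scaler_sumr; apply: eq_bigr => i _; rewrite dcoefZ scalerA.
Qed.

Lemma dual_expansion_geodesic n (i : dpair G n) :
  dual_expansion n (pbo (pop (geodesic i))) = pbo (pop (geodesic i)).
Proof.
rewrite /dual_expansion (bigD1 i) //= big1 => [|j ji].
  by rewrite addr0 dcoef_geodesic eqxx scale1r.
by rewrite dcoef_geodesic (negPf ji) scale0r.
Qed.

Hypothesis V2G : V2 G.

Lemma long_dual p : long p -> dual_ideal (pbo (pop p)).
Proof.
move=> /V2G.2[_ [q /two_shortly_congruent_dual[_ hpq] /two_reducible_dual hq]].
by rewrite -[pbo _](subrK (pbo (pop q))); apply: idealD.
Qed.

Lemma shortest_dual p q : shortest p -> shortest q -> connect_same p q ->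
  dual_ideal (pbo (pop p) - pbo (pop q)).
Proof. by move=> sp sq /(V2G.1 _ _ sp sq)/two_shortly_congruent_dual[]. Qed.

Lemma dual_expansion_path n p : plen p = n ->
  dual_ideal (pbo (pop p) - dual_expansion n (pbo (pop p))).
Proof.
move=> pn; have [lp|] := pselect (long p).
  rewrite /dual_expansion big1 => [|j _]; first by rewrite subr0; apply: long_dual.
  rewrite dcoef_pop; case: and3P => [[_ /eqP es /eqP ee]|]; last by rewrite scale0r.
  by case: lp; rewrite /shortest es ee pn; apply/eqP/(valP j).
move/contrapT => sp.
have dp : dist (pstart p, pend p).1 (pstart p, pend p).2 == Some n.
  by rewrite -pn; apply/eqP.
pose i : dpair G n := exist _ (pstart p, pend p) dp.
have [es ee el] := geodesicP i.
have -> : dual_expansion n (pbo (pop p)) = pbo (pop (geodesic i)).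
  rewrite -dual_expansion_geodesic; apply: eq_bigr => j _.
  by rewrite !dcoef_pop es ee el pn.
apply: shortest_dual; [by []|rewrite /shortest es ee el; exact/eqP|by split].
Qed.

(** In the dual algebra a shortest path equals the chosen geodesic with the same
    ends, by the first half of [V2], and a long path is zero, by the second. *)
Lemma dual_expansionP n (f : KGop) : homog n f -> dual_ideal (f - dual_expansion n f).
Proof.
move: f; apply: homog_ind => [|f g hf hg|c f hf|r].
- rewrite -[X in X - _](scale0r 0) -[X in dual_expansion _ X](scale0r 0) dual_expansionZ.
  by rewrite -scalerBr scale0r; case: (ideal_genP dual_rel).
- by rewrite dual_expansionD opprD addrACA; exact: (idealD hf hg).
- by rewrite dual_expansionZ -scalerBr; apply: idealZ.
by have [p <-] := pop_surj r; rewrite plen_pop; apply: dual_expansion_path.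
Qed.

End QuadraticDual.

(** * Scalars and path products in a quotient of the path algebra *)

(** A scalar acts as a constant function of [S]. The definition is locked, as
    comparing two scalars by computation would unfold the quotient ring. *)
HB.lock Definition scal (K : fieldType) (G : digraph) (X : set (pathalg K G)) (c : K) :
  quotring X := qemb0 X [ffun=> c].

Section Scalars.
Variables (K : fieldType) (G : digraph) (X : set (pathalg K G)).
Local Notation A := (quotring X).
Local Notation scal := (scal X).

Lemma qpiZ c (f : pathalg K G) : qpi X (c *: f) = qpi X f * scal c.
Proof. by rewrite scal.unlock pscale_emb0 rmorphM. Qed.

Lemma scalE c : scal c = qpi X (c *: (1 : pathalg K G)).
Proof. by rewrite qpiZ rmorph1 mul1r. Qed.

Lemma scalD c d : scal (c + d) = scal c + scal d.
Proof. by rewrite !scalE scalerDl raddfD. Qed.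

Lemma scal0 : scal 0 = 0.
Proof. by rewrite scalE scale0r raddf0. Qed.

Lemma scal1 : scal 1 = 1.
Proof. by rewrite scalE scale1r rmorph1. Qed.

Lemma scalM c d : scal (c * d) = scal c * scal d.
Proof. by rewrite scalE mulrC -scalerA qpiZ -scalE. Qed.

Lemma scal_comm c (a : A) : scal c * a = a * scal c.
Proof.
have [f ->] := qpi_surj a.
by rewrite -qpiZ scalE -rmorphM -pscalerAl mul1r.
Qed.

Lemma qelt_qemb0 x s (t : {ffun G -> K}) :
  qelt X x s * qemb0 X t = qelt X x s * scal (t (last x s)).
Proof.
transitivity (qpi X (pelt K x s * emb0 t)); first by rewrite rmorphM.
by rewrite pelt_emb0 qpiZ.
Qed.

(** On [A e_x] the right action of [S] is through evaluation at [x]. *)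
Lemma idem_qemb0 (a : A) x (t : {ffun G -> K}) :
  a = a * qelt X x [::] -> a * qemb0 X t = a * scal (t x).
Proof. by move=> ->; rewrite -!mulrA qelt_qemb0. Qed.

Lemma qemb0_delta x : qemb0 X [ffun y => (y == x)%:R] = qelt X x [::].
Proof.
congr qpi; rewrite /emb0 (bigD1 x) //= big1 => [|y yx].
  by rewrite ffunE eqxx scale1r addr0.
by rewrite ffunE (negPf yx) scale0r.
Qed.

Lemma qelt_cat x s t : qelt X x s * qelt X (last x s) t = qelt X x (s ++ t).
Proof.
rewrite -rmorphM; congr qpi; rewrite /pelt.
case: insubP => [p hp pE|/negPf nh] /=; last first.
  by rewrite mul0r insubF //= cat_path nh.
case: insubP => [q hq qE|/negPf nh] /=; last first.
  by rewrite mulr0 insubF //= cat_path nh andbF.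
rewrite pbasisM /pmul_basis.
have [r rE] : exists r, pcat p q = Some r.
  by apply: pcat_def; rewrite /pend /pstart /ptail pE qE.
rewrite rE; case/pcatP: rE => _ rE.
have -> : (x, s ++ t) = gpval r by rewrite rE /pstart /ptail pE qE.
by rewrite valK.
Qed.

Lemma qelt1 x y : ~~ arrow x y -> qelt X x [:: y] = 0.
Proof. by move=> h; rewrite /qelt /pelt insubF ?raddf0 //= (negPf h). Qed.

End Scalars.

(** * The isomorphism with the terms of the Koszul complex *)

Section Comparison.
Variables (K : fieldType) (G : digraph).
Local Notation T := (@trel K G).
Local Notation A := (quotring T).
Local Notation KGop := (pathalg K (opdigraph G)).
Local Notation pbo := (@pbasis K (opdigraph G)).
Local Notation dual_rel := (quad_perp T).
Local Notation A' := (quotring dual_rel).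
Local Notation A'_ := (grpart dual_rel).

Definition qcoef n (i : dpair G n) (a : A') : K := dcoef i (repr a).

(** The coordinate does not depend on the representative, because geodesic
    counts vanish on the dual ideal. *)
Lemma qcoef_pi n (i : dpair G n) f : qcoef i (qpi dual_rel f) = dcoef i f.
Proof.
apply/eqP; rewrite -subr_eq0 -pformB; apply/eqP/pform_ends_ideal.
  exact/eqP/(valP i).
by apply/qpi_eq; rewrite /qpi reprK.
Qed.

Lemma qcoefD n (i : dpair G n) a b : qcoef i (a + b) = qcoef i a + qcoef i b.
Proof.
have [f ->] := qpi_surj a; have [g ->] := qpi_surj b.
by rewrite -raddfD !qcoef_pi dcoefD.
Qed.

(** The reverse of a path from [x] to [y] ends at [x], so [S] acts on it from the
    right by evaluation at [x]. *)
Lemma qcoef_qemb0 n (i : dpair G n) a s :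
  qcoef i (a * qemb0 dual_rel s) = s (val i).1 * qcoef i a.
Proof.
have [f ->] := qpi_surj a; rewrite -(rmorphM (qpi dual_rel)) !qcoef_pi.
elim/palg_ind: f => [|f g hf hg|c f hf|r].
- by rewrite mul0r dcoef0 mulr0.
- by rewrite mulrDl !dcoefD mulrDr hf hg.
- rewrite -(pscalerAl c f); apply: etrans (dcoefZ i c _) _; rewrite hf mulrCA.
  by congr (_ * _); apply: esym (dcoefZ i c f).
have [p <-] := pop_surj r; rewrite basis_emb0 dcoefZ.
rewrite pend_pop dcoef_pop; case: and3P => [[_ /eqP -> _]//|_].
by rewrite !mulr0.
Qed.

Lemma KG_comp_idem n (f : KG K G n) i :
  (KGval f i : A) = KGval f i * qelt T (val i).1 [::].
Proof.
have /asboolP/(_ i)[a ->] := KGvalP f.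
by rewrite -mulrA (qelt_cat T (val i).1 [::] [::]).
Qed.

Lemma KG_comp_qemb0 n (f : KG K G n) i (s : {ffun G -> K}) :
  (KGval f i : A) * qemb0 T s = KGval f i * scal T (s (val i).1).
Proof. exact: idem_qemb0 (KG_comp_idem f i). Qed.

Lemma KG_comp_qcoef n (f : KG K G n) i (a : A') (s : {ffun G -> K}) :
  (KGval f i : A) * scal T (qcoef i (a * qemb0 dual_rel s)) =
  (KGval f i : A) * scal T (qcoef i a) * qemb0 T s.
Proof.
rewrite qcoef_qemb0; have := KG_comp_qemb0 f i s.
move: (KGval f i : A) (qcoef i a) => u c us.
by rewrite scalM mulrA -us -[LHS]mulrA -[RHS]mulrA scal_comm.
Qed.

Lemma gr_scal c : gr (X := T) 0 (scal T c).
Proof. by rewrite scal.unlock; apply: gr_qemb0. Qed.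

Lemma gr_ltW m n (a : A) : (m <= n)%N -> gr_lt m a -> gr_lt n a.
Proof.
move=> mn [f hf <-]; exists f => // p pf.
by apply: leq_trans (hf p pf) mn.
Qed.

Lemma gr_lt_scal c : gr_lt (X := T) 1 (scal T c).
Proof. by rewrite scal.unlock; exists (emb0 [ffun=> c]) => //; apply: supported_emb0. Qed.

(** The homomorphism whose value at the reversed geodesic of the pair [i] is the
    component [f i]. *)
Definition to_koszul_fun n (f : KG K G n) : A'_ n -> A^o :=
  fun a => \sum_i (KGval f i : A) * scal T (qcoef i (grval a)).

Lemma to_koszul_subproof n (f : KG K G n) : to_koszul_fun f \in @koszul_pred K G T n.
Proof.
apply/asboolP; split; first split=> [a b|a s].
- rewrite -big_split; apply: eq_bigr => i _.
  transitivity ((KGval f i : A) * scal T (qcoef i (grval a + grval b))) => //.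
  by rewrite qcoefD scalD mulrDr.
- rewrite mulr_suml; apply: eq_bigr => i _.
  exact: (KG_comp_qcoef f i (grval a) s).
have hN i : exists N, gr_lt N (KGval f i : A) by apply: gr_lt_ex.
have [N hN'] := choice hN.
exists (\max_i N i + 1)%N => a; apply: gr_lt_sum => i _.
apply: gr_ltM (gr_lt_scal _); apply: gr_ltW (hN' i).
exact: leq_bigmax.
Qed.

Definition to_koszul n (f : KG K G n) : koszul T n :=
  KoszulHom (to_koszul_subproof f).

Lemma to_koszul_linear n : linear (@to_koszul n).
Proof.
move=> c f g; apply: val_inj; apply/funext => a.
transitivity (c * (to_koszul_fun f a : A) + to_koszul_fun g a) => //.
rewrite mulr_sumr -big_split; apply: eq_bigr => i _.
transitivity ((c * (KGval f i : A) + KGval g i) * scal T (qcoef i (grval a))).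
  by congr (_ * _); rewrite /= !ffunE.
by rewrite mulrDl mulrA.
Qed.
HB.instance Definition _ n := GRing.isLinear.Build A (KG K G n) (koszul T n) *:%R
  (@to_koszul n) (@to_koszul_linear n).

Lemma geodesic_gr n (i : dpair G n) :
  qpi dual_rel (pbo (pop (geodesic i))) \in gr_pred n.
Proof.
apply/asboolP; exists (pbo (pop (geodesic i))) => //.
by apply: supported_basis; have [_ _ el] := geodesicP i; rewrite /= plen_pop el.
Qed.

Definition dual_geodesic n (i : dpair G n) : A'_ n := GrPart (geodesic_gr i).

Lemma to_koszul_geodesic n (f : KG K G n) i :
  to_koszul f (dual_geodesic i) = KGval f i.
Proof.
rewrite /= /to_koszul_fun (bigD1 i) // big1 => [|j ji].
  by rewrite /= qcoef_pi dcoef_geodesic eqxx scal1 mulr1 addr0.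
by rewrite /= qcoef_pi dcoef_geodesic (negPf ji) scal0 mulr0.
Qed.

Section ExpansionOfHoms.
Hypothesis V2G : V2 G.

(** The geodesic classes span the dual algebra over [S]; this is where [V2]
    enters. *)
Lemma dual_geodesic_expansion n (a : A'_ n) :
  a = \sum_i grscale (dual_geodesic i) [ffun=> qcoef i (grval a)].
Proof.
apply: val_inj; rewrite raddf_sum /=.
have /asboolP[f hf fa] := grvalP a; rewrite -fa.
transitivity (qpi dual_rel (dual_expansion n f)).
  by apply/qpi_eq; apply: dual_expansionP.
rewrite raddf_sum; apply: eq_bigr => i _ /=.
by rewrite qpiZ scal.unlock qcoef_pi.
Qed.

Lemma koszul_expansion n (phi : koszul T n) a :
  phi a = \sum_i (phi (dual_geodesic i) : A) * scal T (qcoef i (grval a)) :> A.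
Proof.
have /asboolP[[phiD phiS] _] := koszul_funP phi.
have phi0 : phi 0 = 0 :> A.
  by apply: (addIr (phi 0 : A)); rewrite add0r; have := phiD 0 0; rewrite addr0 => /esym.
rewrite {1}(dual_geodesic_expansion a).
rewrite (big_morph (phi : A'_ n -> A) phiD phi0); apply: eq_bigr => i _.
by rewrite phiS scal.unlock.
Qed.

(** Right [S]-linearity forces the value at the reverse of a path from [x] to
    [y] into [A e_x]. *)
Lemma koszul_geodesic_idem n (phi : koszul T n) (i : dpair G n) :
  phi (dual_geodesic i) = (phi (dual_geodesic i) : A) * qelt T (val i).1 [::] :> A.
Proof.
have /asboolP[[_ phiS] _] := koszul_funP phi.
pose s : {ffun G -> K} := [ffun x => (x == (val i).1)%:R].
transitivity (phi (grscale (dual_geodesic i) (s : {ffun opdigraph G -> K})) : A).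
  congr (phi _ : A); apply: val_inj => /=.
  have [es _ _] := geodesicP i.
  transitivity (qpi dual_rel (pbo (pop (geodesic i)) * @emb0 K (opdigraph G) s)).
    by rewrite basis_emb0 pend_pop ffunE es eqxx scale1r.
  by rewrite rmorphM.
by rewrite phiS qemb0_delta.
Qed.

Definition of_koszul_val n (phi : koszul T n) : {ffun dpair G n -> (Omega K G)^o} :=
  [ffun i => phi (dual_geodesic i)].

Lemma of_koszul_subproof n (phi : koszul T n) : of_koszul_val phi \in @KG_pred K G n.
Proof.
apply/asboolP => i; rewrite ffunE; exists (phi (dual_geodesic i)).
exact: koszul_geodesic_idem.
Qed.

Definition of_koszul n (phi : koszul T n) : KG K G n := KGElt (of_koszul_subproof phi).

Lemma to_koszulK n : cancel (@to_koszul n) (@of_koszul n).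
Proof.
move=> f; apply: val_inj; apply/ffunP => i.
by rewrite ffunE to_koszul_geodesic.
Qed.

Lemma of_koszulK n : cancel (@of_koszul n) (@to_koszul n).
Proof.
move=> phi; apply: val_inj; apply/funext => a.
rewrite [RHS]koszul_expansion; apply: eq_bigr => i _.
by rewrite ffunE.
Qed.

Lemma koszul_ext n (phi psi : koszul T n) :
  (forall i, phi (dual_geodesic i) = psi (dual_geodesic i)) -> phi = psi.
Proof.
move=> h; apply: (can_inj (@of_koszulK n)); apply: val_inj; apply/ffunP => i.
by rewrite !ffunE.
Qed.

End ExpansionOfHoms.

End Comparison.

(** * The differential *)

Section Differential.
Variables (K : fieldType) (G : digraph).
Local Notation T := (@trel K G).
Local Notation A := (quotring T).

Lemma KGvalD n (f g : KG K G n) i :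
  KGval (f + g) i = (KGval f i : A) + KGval g i :> A.
Proof. by rewrite /= ffunE. Qed.

Lemma KGvalZ n (c : Omega K G) (f : KG K G n) i :
  KGval (c *: f) i = c * (KGval f i : A) :> A.
Proof. by rewrite /= ffunE. Qed.

Lemma KGval_sum n (I : Type) (s : seq I) (P : pred I) (F : I -> KG K G n) i :
  KGval (\sum_(k <- s | P k) F k) i = \sum_(k <- s | P k) (KGval (F k) i : A) :> A.
Proof.
apply: (big_morph (fun f : KG K G n => KGval f i : A)) => [f g|]; first exact: KGvalD.
by rewrite /= ffunE.
Qed.

Lemma kappaE n x y (i : dpair G n) :
  KGval (kappa K n x y) i = (if val i == (x, y) then qelt T x [::] else 0) :> A.
Proof. by rewrite ffunE. Qed.

(** The component at [(x, y)] collects right multiplication by [(u, x)] of the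
    components at [(u, y)]. The arrow condition is left implicit, since
    [qelt T u [:: x]] is zero when [(u, x)] is not an arrow. *)
Definition KG_diff_val n (f : KG K G n.+1) : {ffun dpair G n -> (Omega K G)^o} :=
  [ffun i => \sum_(j : dpair G n.+1 | (val j).2 == (val i).2)
     (KGval f j : A) * qelt T (val j).1 [:: (val i).1]].

Lemma KG_diff_subproof n (f : KG K G n.+1) : KG_diff_val f \in @KG_pred K G n.
Proof.
apply/asboolP => i; rewrite ffunE.
exists (\sum_(j : dpair G n.+1 | (val j).2 == (val i).2)
     (KGval f j : A) * qelt T (val j).1 [:: (val i).1]).
rewrite mulr_suml; apply: eq_bigr => j _.
by rewrite -mulrA (qelt_cat T (val j).1 [:: (val i).1] [::]).
Qed.

Definition KG_diff n (f : KG K G n.+1) : KG K G n := KGElt (KG_diff_subproof f).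

Lemma KG_diffE n (f : KG K G n.+1) i :
  KGval (KG_diff f) i = \sum_(j : dpair G n.+1 | (val j).2 == (val i).2)
     (KGval f j : A) * qelt T (val j).1 [:: (val i).1] :> A.
Proof. by rewrite ffunE. Qed.

Lemma KG_ext n (f g : KG K G n) : (forall i, KGval f i = KGval g i :> A) -> f = g.
Proof. by move=> h; apply: val_inj; apply/ffunP. Qed.

Lemma KG_diff_linear n : linear (@KG_diff n).
Proof.
move=> c f g; apply: KG_ext => i.
transitivity (c * (KGval (KG_diff f) i : A) + KGval (KG_diff g) i); last first.
  by rewrite /= !ffunE.
rewrite !KG_diffE mulr_sumr -big_split; apply: eq_bigr => j _.
transitivity ((c * (KGval f j : A) + KGval g j) * qelt T (val j).1 [:: (val i).1]).
  by congr (_ * _); rewrite /= !ffunE.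
by rewrite mulrDl mulrA.
Qed.
HB.instance Definition _ n := GRing.isLinear.Build A (KG K G n.+1) (KG K G n) *:%R
  (@KG_diff n) (@KG_diff_linear n).

Lemma KG_expansion n (f : KG K G n) :
  f = \sum_i (KGval f i : Omega K G) *: kappa K n (val i).1 (val i).2.
Proof.
apply: KG_ext => i; rewrite KGval_sum (bigD1 i) // big1 => [|j ji].
  rewrite KGvalZ kappaE -surjective_pairing eqxx.
  exact: etrans (KG_comp_idem f i) (esym (addr0 _)).
rewrite KGvalZ kappaE -surjective_pairing (inj_eq val_inj) eq_sym (negPf ji).
exact: mulr0.
Qed.

(** Both sides have the component [(x, v)] at each pair [(v, y)] with
    [d(v, y) = n], and zero elsewhere. *)
Lemma KG_diffP : KG_diff_spec (fun n => @KG_diff n).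
Proof.
move=> n x y dxy; apply: KG_ext => i; rewrite KG_diffE KGval_sum.
under [RHS]eq_bigr => v _ do rewrite KGvalZ kappaE.
pose j : dpair G n.+1 := exist _ (x, y) (introT eqP dxy).
transitivity (if (val i).2 == y then qelt T x [:: (val i).1] else 0).
  case: eqP => [iy|niy].
    rewrite (bigD1 j) /= ?iy ?eqxx // big1 => [|k /andP[_ kj]].
      by rewrite kappaE eqxx addr0 (qelt_cat T x [::] [:: _]).
    by rewrite kappaE -[(x, y)]/(val j) (inj_eq val_inj) (negPf kj) mul0r.
  rewrite big1 // => k /eqP ki; rewrite kappaE; case: eqP => [kE|]; last by rewrite mul0r.
  by case: niy; rewrite -ki kE.
have [axi|nax] := boolP (arrow x (val i).1); last first.
  rewrite qelt1 // if_same big1 // => v /andP[]; rewrite dist_arrow => axv _.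
  case: eqP => [iE|_]; last by rewrite mulr0.
  by move: nax; rewrite iE axv.
case: eqP => [iy|niy].
  rewrite (bigD1 (val i).1) /=; last first.
    by rewrite dist_arrow axi -iy; apply: (valP i).
  rewrite big1 => [|v /andP[_ vi]].
    rewrite addr0 -iy -surjective_pairing eqxx.
    by rewrite (qelt_cat T x [:: _] [::]).
  case: eqP => [iE|_]; last by rewrite mulr0.
  by move: vi; rewrite iE eqxx.
rewrite big1 // => v _; case: eqP => [iE|_]; last by rewrite mulr0.
by case: niy; rewrite iE.
Qed.

(** The elements [kappa] generate the module. *)
Lemma KG_diff_unique (d : forall n, {linear KG K G n.+1 -> KG K G n}) :
  KG_diff_spec d -> forall n f, d n f = KG_diff f.
Proof.
move=> dP n f; rewrite (KG_expansion f) !linear_sum; apply: eq_bigr => i _.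
rewrite !linearZ /= dP ?KG_diffP //; exact/eqP/(valP i).
Qed.

(** Write [k = (x, y)] and [i = (z, y)], at distances [n.+2] and [n]. Every middle
    vertex of a path of length 2 from [x] to [z] is at distance [n.+1] from [y],
    so the sum runs over all of them and equals [t_(x,z)], which is a relation as
    then [d(x, z) = 2]; if there is no such path, every term is zero. *)
Lemma sum_two_steps n (k : dpair G n.+2) (i : dpair G n) :
  (val k).2 = (val i).2 ->
  \sum_(j : dpair G n.+1 | (val j).2 == (val i).2)
     qelt T (val k).1 [:: (val j).1; (val i).1] = 0.
Proof.
case: k i => -[x y] /= /eqP dxy [[z y'] /= dzy] yy'; rewrite -{}yy' in dzy *.
move/eqP: dzy => dzy.
pose P v := arrow x v && arrow v z.
have dP v : P v -> dist v y = Some n.+1 /\ dist x z = Some 2%N.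
  by case/andP=> xv vz; apply: dist_two_steps dxy dzy.
rewrite (bigID (fun j => P (val j).1)) /= [X in _ + X]big1 => [|j /andP[_ nP]]; last first.
  by rewrite /qelt /pelt insubF ?raddf0 //= andbT; apply/negbTE.
rewrite addr0.
transitivity (\sum_(v | P v) qelt T x [:: v; z]).
  rewrite (reindex_omap (fun j : dpair G n.+1 => (val j).1) (fun v => insub (v, y))) /=.
    apply: eq_bigl => j; rewrite andbC; congr (_ && _).
    apply/eqP/eqP => [<-|]; first by rewrite -surjective_pairing valK.
    by case: insubP => // u _ uE [<-]; rewrite uE.
  by move=> v /dP[/eqP dv _]; rewrite insubT.
case: (pickP P) => [v /dP[_ dxz]|nP]; last by rewrite big_pred0.
transitivity (qpi T (tsum K x z)); first by rewrite raddf_sum.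
rewrite -[RHS](raddf0 (qpi T)); apply/qpi_eq; rewrite subr0 => I [_]; apply.
by exists x, z.
Qed.

Lemma KG_diff_diff n (f : KG K G n.+2) : KG_diff (KG_diff f) = 0.
Proof.
apply: KG_ext => i; rewrite KG_diffE.
transitivity (0 : A); last by rewrite /= ffunE.
under eq_bigr => j _ do rewrite KG_diffE mulr_suml.
rewrite (exchange_big_dep (fun k => (val k).2 == (val i).2)) => [|j k /eqP ji /eqP kj];
  last by rewrite kj ji.
rewrite big1 // => k /eqP ki.
transitivity ((KGval f k : A) * \sum_(j : dpair G n.+1 | (val j).2 == (val i).2)
     qelt T (val k).1 [:: (val j).1; (val i).1]); last first.
  by rewrite sum_two_steps // mulr0.
rewrite mulr_sumr; apply: eq_big => [j|j _].
  by rewrite ki; case: eqP => // ->; rewrite eqxx.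
by rewrite -mulrA (qelt_cat T (val k).1 [:: _] [:: _]).
Qed.

Lemma gr_sum n (I : Type) (s : seq I) (P : pred I) (F : I -> A) :
  (forall i, P i -> gr n (F i)) -> gr n (\sum_(i <- s | P i) F i).
Proof.
move=> h; elim/big_ind: _ => //; first exact: gr0.
exact: grD.
Qed.

Lemma KG_degE n m (f : KG K G n) : KG_deg m f =
  (if (n <= m)%N then forall i, gr (m - n) (KGval f i : A) else f = 0).
Proof. by []. Qed.

(** The defining condition outside the range of degrees is an equality of
    underlying functions; this restates it in the module. *)
Lemma koszul_degP (X : set (pathalg K G)) n m (phi : koszul X n) : koszul_deg m phi <->
  (if (n <= m)%N then forall a, gr (m - n) (phi a : quotring X)
   else phi = 0 :> koszul X n).
Proof.
rewrite /koszul_deg /mkset; case: ifP => // _; split=> [e|->//].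
by apply: val_inj; exact: e.
Qed.

Lemma KG_diff_deg n m (f : KG K G n.+1) : KG_deg m f -> KG_deg m (KG_diff f).
Proof.
rewrite !KG_degE; case: ifP => [nm fm|_ ->]; last first.
  rewrite (linear0 (@KG_diff n)); case: ifP => // _ i.
  rewrite [KGval 0]/(0 : {ffun dpair G n -> (Omega K G)^o}) ffunE; exact: gr0.
rewrite (ltnW nm) => i; rewrite KG_diffE; apply: gr_sum => j _.
have -> : (m - n = m - n.+1 + 1)%N by rewrite addn1 subnSK.
exact: grM (fm j) (gr_qelt T _ [:: _]).
Qed.

Lemma to_koszul_deg n m (f : KG K G n) :
  KG_deg m f <-> koszul_deg m (to_koszul f).
Proof.
rewrite KG_degE; apply: (iff_trans _ (iff_sym (koszul_degP _ _))); case: ifP => _; split.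
- move=> fm a; apply: gr_sum => i _; rewrite -[(m - n)%N]addn0.
  exact: grM (fm i) (gr_scal _ _).
- by move=> fm i; rewrite -to_koszul_geodesic; apply: fm.
- by move=> ->; apply: (linear0 (@to_koszul K G n)).
move=> f0; apply: (can_inj (@to_koszulK K G n)); rewrite f0.
exact: esym (linear0 (@to_koszul K G n)).
Qed.

Local Notation dual_rel := (quad_perp T).

(** Appending the reversed arrow [(u, v)] to a reversed geodesic prolongs the
    geodesic by one step at its start. *)
Lemma dcoef_arrow n (i : dpair G n) (j : dpair G n.+1) (u v : G) : arrow u v ->
  dcoef j (pbasis K (pop (geodesic i)) * pelt K (v : opdigraph G) [:: u]) =
  [&& v == (val i).1, u == (val j).1 & (val j).2 == (val i).2]%:R.
Proof.
move=> uv; have [es ee el] := geodesicP i.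
have hr : path (@arrow G) u [:: v] by rewrite /= uv.
pose r := @GPath G (u, [:: v]) hr.
have -> : pelt K (v : opdigraph G) [:: u] = pbasis K (pop r).
  by rewrite /pelt -[(v, [:: u])]/(gpval (pop r)) valK.
rewrite pbasisM /pmul_basis; case: eqP => [vi|nvi].
  have [t rt] : exists t, pcat r (geodesic i) = Some t by apply: pcat_def; rewrite es.
  rewrite (pcat_pop rt) /= dcoef_pop (pcat_len rt) (pcat_start rt) (pcat_end rt).
  by rewrite el add1n eqxx ee (eq_sym (val i).2).
by rewrite /pcat pend_pop es ifN ?dcoef0 //; apply/eqP => e; apply: nvi.
Qed.

(** Two homomorphisms agree if they agree on geodesics, and at the geodesic of
    [(x, y)] both sides are the sum over the arrows [(u, x)] with
    [d(u, y) = n.+1] of [f (u, y)] times [(u, x)]. *)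
Lemma to_koszul_diff (V2G : V2 G) n (f : KG K G n.+1) :
  to_koszul (KG_diff f) = koszul_diff (to_koszul f).
Proof.
apply: koszul_ext => // i; rewrite to_koszul_geodesic KG_diffE.
rewrite -[RHS]/(koszul_diff_fun (to_koszul f) (dual_geodesic K i)) /koszul_diff_fun.
transitivity (\sum_(e : G * G | arrow e.1 e.2) \sum_(j : dpair G n.+1)
   (KGval f j : A) * scal T ([&& e.2 == (val i).1, e.1 == (val j).1
     & (val j).2 == (val i).2]%:R) * qelt T e.1 [:: e.2]); last first.
  apply: eq_bigr => e ae; rewrite -mulr_suml; congr (_ * _); apply: eq_bigr => j _.
  congr (_ * scal _ _); rewrite -(dcoef_arrow i j ae) -qcoef_pi.
  by congr (qcoef _ _); rewrite rmorphM.
rewrite exchange_big big_mkcond; apply: eq_bigr => j _.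
case: ifP => _; last first.
  by rewrite big1 // => e _; rewrite !andbF scal0 mulr0 mul0r.
have [a|na] := boolP (arrow (val j).1 (val i).1); last first.
  rewrite qelt1 // mulr0 big1 // => e ae; case: and3P => [[/eqP e2 /eqP e1 _]|_].
    by move: na; rewrite -e1 -e2 ae.
  by rewrite scal0 mulr0 mul0r.
rewrite (bigD1 ((val j).1, (val i).1)) // big1 => [|e /andP[_ ne]].
  by rewrite !eqxx scal1 mulr1; apply: etrans (esym (addr0 _)).
case: and3P => [[/eqP e2 /eqP e1 _]|_].
  by move: ne; rewrite -e1 -e2 -surjective_pairing eqxx.
by rewrite scal0 mulr0 mul0r.
Qed.

End Differential.

Theorem proposition6p6 (K : fieldType) (G : digraph) (hG : V2 G) :
  exists d : forall n : nat, {linear KG K G n.+1 -> KG K G n},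
    [/\ KG_diff_spec d,
        (forall d' : forall n : nat, {linear KG K G n.+1 -> KG K G n},
           KG_diff_spec d' -> forall n f, d' n f = d n f),
        is_chain_complex (KG_seq d)
      & chain_isomorphic (KG_seq d) (koszul_complex (@trel K G))].
Proof.
exists (fun n => @KG_diff K G n); split.
- exact: KG_diffP.
- exact: KG_diff_unique.
- by split=> [n m c|n c]; [apply: KG_diff_deg|apply: KG_diff_diff].
exists (fun n => @to_koszul K G n); split.
- by move=> n; exists (@of_koszul K G n); [apply: to_koszulK|apply: (of_koszulK hG)].
- by move=> n m c; apply: to_koszul_deg.
- by move=> n c; apply: (to_koszul_diff hG).
Qed.
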